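(* Let $k=k(n)$, and let $G=G_{n,k}$ be the two-dimensional $k$-nearest neighbor graph (with the Euclidean norm). Suppose that $G$ is $\kappa$-connected for $\kappa=5\cdot 10^7$ with high probability. Then $G$ has a Hamilton cycle with high probability.
   Context: For each $n$, the vertex set of $G_{n,k}$ is the set of points of a Poisson process of density $1$ in the $\sqrt n\times\sqrt n$ square $S_n$. Each vertex is joined to its $k$ nearest neighbors (in the Euclidean metric) among the other points of the process in $S_n$; the direction of edges is ignored, so $G_{n,k}$ is the simple undirected graph in which $x$ and $y$ are adjacent if and only if $y$ is one of the $k$ nearest neighbors of $x$ or $x$ is one of the $k$ nearest neighbors of $y$. ''With high probability'' (whp) means with probability tending to $1$ as $n\to\infty$. *)

(* Defs.v *)
From HB Require Import structures.
From mathcomp Require Import all_boot all_order all_algebra finmap.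
From mathcomp Require Import all_classical all_reals all_analysis.

Set Implicit Arguments.
Unset Strict Implicit.
Unset Printing Implicit Defensive.

Import Order.TTheory GRing.Theory Num.Theory.
Import numFieldTopology.Exports.

Local Open Scope classical_set_scope.
Local Open Scope ring_scope.

Definition remove_set (T : finType) (e : rel T) (S : {set T}) : rel T :=
  fun x y => [&& x \notin S, y \notin S & e x y].

Definition kappa_connected (kappa : nat) (T : finType) (e : rel T) : Prop :=
  (kappa < #|T|)%N /\
  forall S : {set T}, (#|S| < kappa)%N ->
    forall x y : T, x \notin S -> y \notin S -> connect (remove_set e S) x y.

(* [ucycle] accepts a single edge traversed back and forth, hence the size
   condition. *)
Definition hamiltonian (T : finType) (e : rel T) : Prop :=
  exists s : seq T, [/\ (3 <= size s)%N, ucycle e s & size s = #|T|].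

(* The norm that the library puts on [R * R] is the max norm. *)
Definition euclid_dist (R : realType) (p q : R * R) : R :=
  Num.sqrt ((p.1 - q.1) ^+ 2 + (p.2 - q.2) ^+ 2).

(* Fewer than [k] other points are strictly closer to [x] than [y] is. When two
   points are equidistant from [x] (a null event for a Poisson process) this may
   select more than [k] neighbours; when [X] has at most [k] points other than
   [x], it selects all of them. *)
Definition is_knn (R : realType) (k : nat) (X : {fset R * R}) : rel X :=
  fun x y => (y != x) &&
    (#|[pred z : X | (z != x) &&
          (euclid_dist (val x) (val z) < euclid_dist (val x) (val y))%R]| < k)%N.

Definition knn_graph (R : realType) (k : nat) (X : {fset R * R}) : rel X :=
  fun x y => is_knn k x y || is_knn k y x.

Definition square (R : realType) (a : R) : set (R * R) :=
  `[0, a]%classic `*` `[0, a]%classic.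

Definition area (R : realType) : set (R * R) -> \bar R :=
  (@lebesgue_measure R \x @lebesgue_measure R)%E.

Definition npoints (R : realType) (T : Type) (X : T -> {fset R * R})
    (B : set (R * R)) : T -> nat :=
  fun w => #|` [fset p in X w | p \in B]%fset |.

Definition mutually_independent (R : realType) (d : measure_display)
    (T : measurableType d) (P : probability T R) (m : nat)
    (N : 'I_m -> T -> nat) : Prop :=
  forall U : 'I_m -> set nat,
    P (\bigcap_(i in [set: 'I_m]) (N i @^-1` U i)) =
    (\prod_(i < m) P (N i @^-1` U i))%E.

(* The second argument of [poisson_prob] is a dummy one; at rate [0] it is the
   Dirac mass at [0]. *)
Definition poisson_process (R : realType) (d : measure_display)
    (T : measurableType d) (P : probability T R) (D : set (R * R))
    (X : T -> {fset R * R}) : Prop :=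
  [/\ forall w p, p \in X w -> D p,
      forall B, measurable B -> measurable_fun setT (npoints X B),
      forall B, measurable B -> forall U : set nat,
        P (npoints X B @^-1` U) = poisson_prob (fine (area (B `&` D))) 0 U
    & forall (m : nat) (B : 'I_m -> set (R * R)),
        (forall i, measurable (B i)) -> trivIset setT B ->
        mutually_independent P (fun i => npoints X (B i))].

(* Inner probabilities, so that no measurability of [E n] is presupposed; when
   every [E n] is measurable this says that [P n (E n)] tends to [1]. *)
Definition whp (R : realType) (d : nat -> measure_display)
    (T : forall n, measurableType (d n)) (P : forall n, probability (T n) R)
    (E : forall n, set (T n)) : Prop :=
  exists A : forall n, set (T n),
    [/\ forall n, measurable (A n),
        forall n, A n `<=` E n
      & (fun n => P n (A n)) @ \oo --> 1%E].

(* Main.v *)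
(* Suppose first that 8 k < ln n, and cut the square into cells of area about
   ln n / 708. With probability at least 1/2, some block of 41 x 41 cells has more
   than k points in a small central square, no point in a moat around it, and
   enough points in each remaining cell to isolate the central square, so the
   graph is disconnected. Connectivity with high probability therefore forces
   ln n <= 8 k for large n.

   In that regime take cells of area about k / 47. A cell is good if it has at
   least kappa points and its surroundings have at most k points, so that points
   of adjacent good cells are adjacent. By Chernoff bounds, with high probability
   all edges are short and only boundedly many strips of cells near a given place
   meet bad cells, so every vertex lies in a rectangle of bounded size inside a
   frame of good cells. There the graph is locally kappa-connected. Since a vertex
   has at most 8 pairwise non-adjacent in-neighbours (one per octant), a local
   independent set has at most kappa vertices, and the argument of Chvatal and
   Erdos, carried out in the rectangle, shows that a longest cycle is
   Hamiltonian. *)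

Require Import Defs.
From mathcomp Require Import all_boot all_order all_algebra finmap.
From mathcomp Require Import all_classical all_reals all_analysis.
From mathcomp Require Import zify ring lra.

Set Implicit Arguments.
Unset Strict Implicit.
Unset Printing Implicit Defensive.

Import Order.TTheory GRing.Theory Num.Theory.
Import numFieldTopology.Exports.

Local Open Scope ring_scope.

(** * Locally connected graphs *)

(** The factor [8] has to serve both regimes. Above the threshold, the exceptional events, summed
    over a number of positions of order [n], have probability at most a constant times
    [n * expR (- (81 / 10 * k))], and [81 / 10 > 8] leaves [n] to the power [- 1 / 80]. Below it, a
    center that has to hold only about [ln n / 8] points keeps the cost of an isolated block at
    about [n] to the power [- (1 - 176 / 10 ^ 4)], less than the number of blocks gains. The main
    obstacle in the dense regime is that the bound for one bad cell decays only like
    [expR (- (21 / 1000 * k))], too weak for a union bound when [k] is near [ln n / 8]; good cells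
    cannot be required everywhere. Bad cells in different strips are independent once each strip is
    trimmed by the reach of a ball, and [390 * 21 / 1000 > 81 / 10] rules out 390 of them at once. A
    rectangle then spans at most 390 strips besides its frame, and the size of [kappa] is what it
    takes to bound independent sets in a window of side [40 * 392 + 136] cells. *)

Definition induced (T : finType) (e : rel T) (A : {set T}) : rel T :=
  fun x y => [&& x \in A, y \in A & e x y].

Lemma induced_connect_sym (T : finType) (e : rel T) (A : {set T}) :
  symmetric e -> connect_sym (induced e A).
Proof.
by move=> esym; apply: sym_connect_sym => x y; rewrite /induced esym andbCA.
Qed.

Lemma connect_boundary (T : finType) (e : rel T) (A : {pred T}) (x y : T) :
  connect e x y -> x \in A -> y \notin A ->
  exists u v : T, [/\ connect e x u, u \in A, v \notin A & e u v].
Proof.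
move=> /connectP[p + ->] xA; elim: p x xA => [|z p IHp] x xA /=.
  by rewrite xA.
move=> /andP[xz /IHp zp] yA; case: (boolP (z \in A)) => zA.
  have [u [v [zu uA vA uv]]] := zp zA yA; exists u, v; split=> //.
  exact: connect_trans (connect1 xz) zu.
by exists x, z; split.
Qed.

Lemma induced_connect_in (T : finType) (e : rel T) (A : {set T}) (x y : T) :
  connect (induced e A) x y -> x \in A -> y \in A.
Proof.
move=> /connectP[p]; elim: p x => [|z p IHp] x /= => [_ -> //|].
by move=> /andP[/and3P[_ zA _] /IHp pz] yE _; exact: pz.
Qed.

(** Rotating [C] to start at the successor of [y] makes [y] its last vertex, so the insertion
    amounts to appending [P]. *)
Lemma ucycle_insert (T : finType) (e : rel T) (C P : seq T) (y : T) :
  ucycle e C -> y \in C -> P != [::] -> uniq P -> ~~ has (mem C) P ->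
  path e y (rcons P (next C y)) ->
  exists2 C' : seq T, ucycle e C' & (size C < size C')%N.
Proof.
move=> uC yC P0 uP CP; rewrite rcons_path => /andP[yP Pa].
have := ucycle_uniq uC => uqC.
set a := next C y in Pa *.
have aC : a \in C by rewrite mem_next.
have [i s rotE] := rot_to aC.
have : fcycle (next C) (rot i C) by rewrite rot_cycle; exact: cycle_next.
rewrite rotE /= rcons_path => /andP[_ /eqP nl].
have lE : last a s = y by apply: (can_inj (prev_next uqC)); rewrite nl.
have := uC; rewrite -(rot_ucycle i) rotE /= => /andP[+ uas].
rewrite /= rcons_path lE => /andP[pas _].
exists (a :: s ++ P); last first.
  rewrite -(size_rot i C) rotE -cat_cons size_cat -[ltnLHS]addn0 ltn_add2l.
  by rewrite lt0n size_eq0.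
apply/andP; split; first by rewrite /= rcons_path cat_path pas lE yP last_cat lE.
rewrite -cat_cons cat_uniq uas uP andbT /=.
apply: contra CP => /hasP[z zP zas]; apply/hasP; exists z => //.
by rewrite inE -(mem_rot i) rotE.
Qed.

(** The classical crossing. Cut [C] into the arcs from [next C y] to [z] and from [next C z] to [y];
    follow the second one to [y], cross along [P] to [z], run the first one backwards, and close up
    by the edge between the two successors. *)
Lemma ucycle_cross (T : finType) (e : rel T) (C P : seq T) (y z : T) :
  symmetric e -> ucycle e C -> y \in C -> z \in C -> y != z ->
  e (next C y) (next C z) ->
  P != [::] -> uniq P -> ~~ has (mem C) P -> path e y (rcons P z) ->
  exists2 C' : seq T, ucycle e C' & (size C < size C')%N.
Proof.
move=> esym uC yC zC yz eab P0 uP CP; rewrite rcons_path => /andP[yP Pz].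
have := ucycle_uniq uC => uqC.
set a := next C y in eab *; set b := next C z in eab *.
have aC : a \in C by rewrite mem_next.
have bC : b \in C by rewrite mem_next.
have ab : a != b by apply: contra yz => /eqP/(can_inj (prev_next uqC)) ->.
have [i p1 p2 _ _ rotE] := rot_to_arc uqC aC bC ab.
have : fcycle (next C) (rot i C) by rewrite rot_cycle; exact: cycle_next.
rewrite rotE /= rcons_path cat_path /= last_cat /=.
move=> /andP[/and3P[_ /eqP nz _] /eqP ny].
have zE : last a p1 = z by apply: (can_inj (prev_next uqC)); rewrite nz.
have yE : last b p2 = y by apply: (can_inj (prev_next uqC)); rewrite ny.
have := uC; rewrite -(rot_ucycle i) rotE => /andP[+ uab].
rewrite /= rcons_path cat_path /= last_cat /= zE yE.
move=> /andP[/and3P[pa1 _ pb2] _].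
have revE : rev (a :: p1) = z :: rev (belast a p1) by rewrite lastI rev_rcons zE.
have lrev : last z (rev (belast a p1)) = a.
  by have := congr1 (last z) revE; rewrite rev_cons last_rcons /=.
exists ((b :: p2) ++ P ++ rev (a :: p1)); last first.
  rewrite -(size_rot i C) rotE -[a :: _]cat_cons !size_cat size_rev addnCA addnC.
  by rewrite -[ltnLHS]add0n ltn_add2r lt0n size_eq0.
apply/andP; split.
  rewrite revE /= rcons_path !cat_path /= pb2 yE yP Pz /=.
  rewrite -[X in path e X]zE rev_path last_cat last_cat /= lrev eab andbT.
  by rewrite (eq_path (e' := e)) // => u v; rewrite esym.
rewrite uniq_catCA cat_uniq uP andTb; apply/andP; split; last first.
  rewrite -(perm_uniq (s1 := (a :: p1) ++ b :: p2)) // perm_catC perm_cat2l.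
  by rewrite perm_sym perm_rev.
rewrite has_sym; apply: contra CP => /hasP[x xP xab]; apply/hasP; exists x => //.
have -> : mem C x = (x \in rot i C) by rewrite mem_rot.
by rewrite rotE -cat_cons mem_cat orbC -(mem_rev (a :: p1)) -mem_cat.
Qed.

Lemma induced_detour (T : finType) (e : rel T) (A : {set T}) (C : seq T)
    (y z d1 d2 : T) :
  A \subset [pred x | x \notin C] -> d1 \in A -> e y d1 -> e d2 z ->
  connect (induced e A) d1 d2 ->
  exists P : seq T,
    [/\ P != [::], uniq P, ~~ has (mem C) P & path e y (rcons P z)].
Proof.
move=> /fintype.subsetP AC d1A yd1 d2z /connectP[p + d2E].
move: d2E d2z => -> d2z pd1; move: d2z.
case/shortenP: pd1 => p' pd1 up' _ d2z.
exists (d1 :: p'); split=> //=.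
  have inC x : x \in A -> x \notin C by move=> /AC; rewrite inE.
  rewrite negb_or inC //= -all_predC; apply/allP => x xp' /=; apply: inC.
  have xp : x \in d1 :: p' by rewrite inE xp' orbT.
  exact: induced_connect_in (path_connect pd1 xp) d1A.
rewrite yd1 rcons_path d2z andbT.
by apply: sub_path pd1 => u v /and3P[].
Qed.

(** Some vertex [x] has two neighbours, and a path joining them after the deletion of [x] closes up
    through [x]. This starts the choice of a longest cycle. *)
Lemma exists_cycle (T : finType) (e : rel T) (kappa : nat) :
  symmetric e -> irreflexive e -> (1 < kappa)%N -> kappa_connected kappa e ->
  exists2 C : seq T, ucycle e C & (2 < size C)%N.
Proof.
move=> esym eirr k1 [kT kc].
have other (S : {set T}) : (#|S| <= kappa)%N -> exists y, y \notin S.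
  move=> Sk; apply/existsP; rewrite -negb_forall; apply/negP => /forallP TS.
  have : (#|T| <= #|S|)%N by apply: subset_leq_card; apply/fintype.subsetP.
  by move: kT Sk; lia.
have nbr (S : {set T}) x : (#|S| < kappa)%N -> x \notin S ->
    exists2 u, u \notin S & e x u.
  move=> Sk xS; have [|y] := other (x |: S).
    by rewrite cardsU1 xS.
  rewrite !inE negb_or => /andP[yx yS].
  have [u [v [_ /eqP -> _ /and3P[_ vS xv]]]] :=
    connect_boundary (kc S Sk x y xS yS) (eqxx x : x \in pred1 x) yx.
  by exists v.
have [x _] := other finset.set0 (ltac:(by rewrite cards0)).
have [||u _ xu] := nbr finset.set0 x; rewrite ?inE ?cards0 //; first by lia.
have xDu : x != u by apply: contraL xu => /eqP ->; rewrite eirr.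
have [||w wu xw] := nbr [set u] x; rewrite ?inE ?cards1 //.
have xDw : x != w by apply: contraL xw => /eqP ->; rewrite eirr.
have /connectP[p pu wE] : connect (remove_set e [set x]) u w.
  by apply: kc; rewrite ?cards1 // inE eq_sym.
move: wE; case/shortenP: pu => p' pu' up' _ wE.
have px : x \notin u :: p'.
  apply/negP; rewrite inE (negPf xDu) /= => xp'.
  have : all (predC1 x) p'.
    move: pu'; move: (u); elim: (p') => //= b q IHq a /andP[/and3P[_ + _]].
    by rewrite inE => -> /IHq.
  by move=> /allP/(_ x xp'); rewrite inE eqxx.
exists [:: x, u & p'].
  rewrite /ucycle /= in px up' *; rewrite px up' xu rcons_path /= -wE esym xw !andbT.
  by apply: sub_path pu' => a b /and3P[].
by case: (p') wE => //= wE; move: wu; rewrite wE inE eqxx.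
Qed.

(* A localized Chvatal-Erdos theorem.  Let [x] on a longest cycle [C] have a
   neighbour [v] off [C], and let [D] be the component of [v] in [Q x] minus [C].
   If [D] has at least [kappa] neighbours on [C] within [Q x], then [v] and the
   successors of those neighbours form too large an independent set; otherwise
   these neighbours cannot separate [v] from the successor of [x], so that [x]
   and its successor are both attached to [D]. *)
Theorem local_chvatal_erdos (T : finType) (e : rel T) (kappa : nat)
    (Q : T -> {set T}) :
  symmetric e -> (1 < kappa)%N -> kappa_connected kappa e ->
  (forall x y : T, (y == x) || e x y -> y \in Q x) ->
  (forall (x : T) (S : {set T}), (#|S| < kappa)%N ->
     forall u w : T, e x u -> e x w -> u \notin S -> w \notin S ->
     connect (induced e (Q x :\: S)) u w) ->
  (forall (x : T) (Z : {set T}),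
     (forall z : T, z \in Z -> exists2 y, y \in Q x & (z == y) || e y z) ->
     {in Z &, forall y z, y != z -> ~~ e y z} -> (#|Z| <= kappa)%N) ->
  irreflexive e -> hamiltonian e.
Proof.
move=> esym k1 kconn Qnbr Qconn Qindep eirr.
have [C0 uC0 sC0] := exists_cycle esym eirr k1 kconn.
pose hasC m := `[< exists2 C : seq T, ucycle e C & size C = m >].
have exC : exists m, hasC m by exists (size C0); apply/asboolP; exists C0.
have ubC m : hasC m -> (m <= #|T|)%N.
  by move=> /asboolP[C /andP[_ /card_uniqP uC] <-]; rewrite -uC max_card.
have [m /asboolP[C uC sC] maxm] := ex_maxnP exC ubC.
have Cmax C' : ucycle e C' -> (size C' <= size C)%N.
  by move=> uC'; rewrite sC; apply: maxm; apply/asboolP; exists C'.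
have C3 : (2 < size C)%N by apply: leq_trans (Cmax _ uC0).
exists C; split=> //; apply: contrapT => CT.
have longer : ~ exists2 C', ucycle e C' & (size C < size C')%N.
  by move=> [C' /Cmax]; rewrite ltnNge => ->.
have uqC := ucycle_uniq uC.
have [x [v [xC vC xv]]] : exists x v, [/\ x \in C, v \notin C & e x v].
  have [v0 v0C] : exists v, v \notin C.
    apply/existsP; rewrite -negb_forall; apply/negP => /forallP TC; apply: CT.
    by rewrite -(card_uniqP uqC); apply: eq_card => z; rewrite TC.
  have [c0 c0C] : exists c, c \in C.
    by case: (C) C3 => // c s _; exists c; rewrite mem_head.
  have [_ /(_ finset.set0 _ c0 v0)] := kconn; rewrite cards0 !inE.
  move=> /(_ (ltac:(lia)) isT isT) /(@connect_boundary _ _ (mem C)).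
  by move=> /(_ c0C v0C)[x [v [_ xC vC /and3P[_ _ xv]]]]; exists x, v.
set A := Q x :\: [set y in C].
pose D := [set z | connect (induced e A) v z].
pose S := [set y in C | (y \in Q x) && [exists d, (d \in D) && e y d]].
have vA : v \in A by rewrite !inE vC Qnbr ?xv ?orbT.
have AC : A \subset [pred z | z \notin C].
  by apply/fintype.subsetP => z; rewrite !inE => /andP[].
have DA d : d \in D -> d \in A.
  by rewrite inE => /induced_connect_in; exact.
have DD d1 d2 : d1 \in D -> d2 \in D -> connect (induced e A) d1 d2.
  rewrite !inE (induced_connect_sym _ esym); exact: connect_trans.
have vD : v \in D by rewrite inE connect0.
have insert y d1 d2 : y \in C -> d1 \in D -> d2 \in D -> e y d1 ->
    e d2 (next C y) -> False.
  move=> yC d1D d2D yd1 d2y; apply: longer.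
  have [P [P0 uP CP yP]] :=
    induced_detour AC (DA _ d1D) yd1 d2y (DD _ _ d1D d2D).
  exact: ucycle_insert uC yC P0 uP CP yP.
have SP y : y \in S -> [/\ y \in C, y \in Q x & exists2 d, d \in D & e y d].
  rewrite inE => /and3P[yC yQ /existsP[d /andP[dD yd]]].
  by split=> //; exists d.
have [kS|Sk] := leqP kappa #|S|.
  pose Z := v |: [set next C y | y in S].
  have nextI : injective (next C) := can_inj (prev_next uqC).
  have cZ : #|Z| = #|S|.+1.
    rewrite cardsU1 card_imset // (_ : v \notin _) //.
    apply/imsetP => -[y /SP[yC _ _] vE].
    by move: vC; rewrite vE mem_next yC.
  suff : (#|Z| <= kappa)%N by rewrite cZ; move: kS; lia.
  (* The successor of a vertex of [Q x] may lie outside [Q x]; this is why the hypothesis covers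
     independent sets in the closed neighbourhood of [Q x]. *)
  apply: (Qindep x).
    move=> z; rewrite !inE => /predU1P[->|/imsetP[y /SP[yC yQ _] ->]].
      by exists v; rewrite ?eqxx // Qnbr ?xv ?orbT.
    by exists y => //; rewrite (next_cycle (ucycle_cycle uC) yC) orbT.
  move=> z1 z2; rewrite !inE => /predU1P[->|/imsetP[y1 /SP[y1C _ [d1 d1D yd1]] ->]].
    move=> /predU1P[->|/imsetP[y2 /SP[y2C _ [d2 d2D yd2]] -> _]].
      by rewrite eqxx.
    by apply/negP => vy2; exact: (insert y2 d2 v).
  move=> /predU1P[-> _|/imsetP[y2 /SP[y2C _ [d2 d2D yd2]] -> y12]].
    by apply/negP; rewrite esym => vy1; exact: (insert y1 d1 v).
  apply/negP => e12; apply: longer.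
  have [P [P0 uP CP yP]] :=
    induced_detour AC (DA _ d1D) yd1 (etrans (esym _ _) yd2) (DD _ _ d1D d2D).
  apply: ucycle_cross esym uC y1C y2C _ e12 P0 uP CP yP.
  by apply: contra y12 => /eqP ->.
have aC : next C x \in C by rewrite mem_next.
have xa : e x (next C x) by exact: next_cycle (ucycle_cycle uC) xC.
have [/SP[_ _ [d dD ad]]|aS] := boolP (next C x \in S).
  by apply: (insert x v d); rewrite // esym.
have vS : v \notin S by apply: contra vC => /SP[].
have aD : next C x \notin D.
  by apply/negP => /DA; rewrite !inE aC.
(* The path from [v] to the successor of [x] leaves [D] through an edge from [z] to [z']. On [C],
   [z'] would belong to [S]; off [C], it would belong to [D]. *)
have [z [z' [_ zD z'D /and3P[zQ z'Q zz']]]] :=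
  connect_boundary (Qconn x S Sk v _ xv xa vS aS) vD aD.
move: z'Q; rewrite !inE => /andP[z'S z'Q].
case: (boolP (z' \in C)) => z'C.
  move: z'S; rewrite z'C z'Q /= => /existsP; apply.
  by exists z; rewrite zD esym.
have z'A : z' \in A by rewrite !inE z'C z'Q.
have zA := DA _ zD.
move: z'D; rewrite inE => /negP; apply; move: zD; rewrite inE => vz.
by apply: connect_trans vz (connect1 _); rewrite /induced zz' zA z'A.
Qed.

(** * Independent sets of nearest neighbour graphs *)

Definition sqdist (R : realType) (p q : R * R) : R :=
  (p.1 - q.1) ^+ 2 + (p.2 - q.2) ^+ 2.

Lemma sqdist_ge0 (R : realType) (p q : R * R) : 0 <= sqdist p q.
Proof. by rewrite addr_ge0 ?sqr_ge0. Qed.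

Lemma euclid_dist_lt (R : realType) (p q p' q' : R * R) :
  (euclid_dist p q < euclid_dist p' q') = (sqdist p q < sqdist p' q').
Proof.
rewrite /euclid_dist -/(sqdist p q) -/(sqdist p' q').
have := sqdist_ge0 p' q'; rewrite le0r => /predU1P[->|/ltr_sqrt -> //].
by rewrite sqrtr0 !ltNge sqrtr_ge0 sqdist_ge0.
Qed.

Definition closer (R : realType) (X : {fset R * R}) (x y : X) : {set X} :=
  [set z | (z != x) && (sqdist (val x) (val z) < sqdist (val x) (val y))].

Lemma is_knnE (R : realType) (k : nat) (X : {fset R * R}) (x y : X) :
  is_knn k x y = (y != x) && (#|closer x y| < k)%N.
Proof.
congr (_ && (_ < _)%N); apply: eq_card => z; rewrite !inE.
by rewrite euclid_dist_lt.
Qed.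

Lemma knn_closer (R : realType) (k : nat) (X : {fset R * R}) (x y z : X) :
  y != x -> ~~ is_knn k x y -> is_knn k x z ->
  sqdist (val x) (val z) < sqdist (val x) (val y).
Proof.
rewrite !is_knnE => -> /=; rewrite -leqNgt => ky /andP[_ zk].
rewrite ltNge; apply/negP => yz.
suff /subset_leq_card : closer x y \subset closer x z.
  by move/(leq_trans ky); rewrite leqNgt zk.
apply/fintype.subsetP => t; rewrite !inE => /andP[->]/= /lt_le_trans; exact.
Qed.

(** All points strictly closer to [x] than a nearest non-neighbour are neighbours, and there are at
    least [k] of them. The second alternative occurs when there are too few points. *)
Lemma knn_card (R : realType) (k : nat) (X : {fset R * R}) (x : X) :
  (k <= #|[set y | is_knn k x y]|)%N \/ forall y, y != x -> is_knn k x y.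
Proof.
have [|small] := leqP k #|[set y | is_knn k x y]|; [by left | right].
move=> y yx; apply: contraT => yk.
have [z /andP[zx zk] zmin] := @arg_minP _ _ X y
  (fun y => (y != x) && ~~ is_knn k x y) (fun y => sqdist (val x) (val y))
  (introT andP (conj yx yk)).
move: zk; rewrite is_knnE zx -leqNgt => zk.
suff /subset_leq_card : closer x z \subset [set y | is_knn k x y].
  by move/(leq_trans zk); rewrite leqNgt small.
apply/fintype.subsetP => t; rewrite !inE => /andP[tx].
by apply: contraLR => tk; rewrite -leNgt zmin // tx.
Qed.

Definition octant (R : realType) (z p : R * R) : bool * bool * bool :=
  (z.1 <= p.1, z.2 <= p.2, `|p.2 - z.2| <= `|p.1 - z.1|).

(** Since [d <= c <= a], both [c ^+ 2] and [d ^+ 2] are at most [a * c]. *)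
Lemma quadrant_dist (R : realDomainType) (a b c d : R) :
  0 <= b <= a -> 0 <= d <= c -> c <= a ->
  (a - c) ^+ 2 + (b - d) ^+ 2 <= a ^+ 2 + b ^+ 2.
Proof. by move=> /andP[? ?] /andP[? ?] ?; nra. Qed.

(* Two vectors of the same octant make an angle of at most 45 degrees. *)
Lemma octant_dist (R : realType) (z p q : R * R) :
  octant z p = octant z q ->
  (sqdist p q <= sqdist p z) || (sqdist p q <= sqdist q z).
Proof.
have gen (a b c d : R) : 0 <= a * c -> 0 <= b * d ->
    (`|b| <= `|a|) = (`|d| <= `|c|) ->
    ((a - c) ^+ 2 + (b - d) ^+ 2 <= a ^+ 2 + b ^+ 2) ||
    ((a - c) ^+ 2 + (b - d) ^+ 2 <= c ^+ 2 + d ^+ 2).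
  move=> ac bd.
  (* Equal signs allow the coordinates to be replaced by their absolute values; exchanging axes or
     vectors then reduces to [quadrant_dist]. *)
  have E (u v : R) : 0 <= u * v -> (u - v) ^+ 2 = (`|u| - `|v|) ^+ 2.
    move=> uv; rewrite !sqrrB !real_normK ?num_real //.
    by rewrite -normrM ger0_norm.
  rewrite (E _ _ ac) (E _ _ bd) -(real_normK (num_real a)) -(real_normK (num_real b)).
  rewrite -(real_normK (num_real c)) -(real_normK (num_real d)).
  move: `|a| `|b| `|c| `|d| (normr_ge0 a) (normr_ge0 b) (normr_ge0 c) (normr_ge0 d).
  move=> {E ac bd} {}a {}b {}c {}d a0 b0 c0 d0.
  case: (leP b a) => ba dc; apply/orP.
    have [ca|ac] := leP c a; [left|right].
      by apply: quadrant_dist; rewrite ?b0 ?d0 // -dc.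
    have := @quadrant_dist R c d a b; rewrite d0 b0 -dc ba (ltW ac).
    by move=> /(_ isT isT isT); rewrite (sqrrB c) (sqrrB a) (sqrrB d) (sqrrB b); lra.
  have {dc} dc : c < d by rewrite ltNge -dc.
  have [db|bd] := leP d b; [left|right].
    have := @quadrant_dist R b a d c; rewrite a0 c0 (ltW ba) (ltW dc) db.
    by move=> /(_ isT isT isT); lra.
  have := @quadrant_dist R d c b a; rewrite a0 c0 (ltW ba) (ltW dc) (ltW bd).
  move=> /(_ isT isT isT).
  by rewrite (sqrrB c) (sqrrB a) (sqrrB d) (sqrrB b); lra.
move=> [e1 e2 e3].
have sgn (u v w : R) : (u <= v) = (u <= w) -> 0 <= (v - u) * (w - u).
  move=> uvw; have [uv|vu] := leP u v.
    by rewrite mulr_ge0 ?subr_ge0 // -uvw.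
  by rewrite mulr_le0 ?subr_le0 ?ltW // ltNge -uvw -ltNge.
have := gen _ _ _ _ (sgn _ _ _ e1) (sgn _ _ _ e2) e3.
rewrite /sqdist (_ : p.1 - z.1 - (q.1 - z.1) = p.1 - q.1); last by ring.
by rewrite (_ : p.2 - z.2 - (q.2 - z.2) = p.2 - q.2); last by ring.
Qed.

Lemma sqdistC (R : realType) (p q : R * R) : sqdist p q = sqdist q p.
Proof. by rewrite /sqdist; ring. Qed.

Lemma knn_graphC (R : realType) (k : nat) (X : {fset R * R}) :
  symmetric (@knn_graph R k X).
Proof. by move=> x y; rewrite /knn_graph orbC. Qed.

Lemma knn_graph_irr (R : realType) (k : nat) (X : {fset R * R}) :
  irreflexive (@knn_graph R k X).
Proof. by move=> x; rewrite /knn_graph /is_knn eqxx. Qed.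

(* Pairwise non-adjacent points with a common out-neighbour [z] lie in distinct
   octants around [z]. *)
Lemma knn_independent_indegree (R : realType) (k : nat) (X : {fset R * R})
    (Z : {set X}) (z : X) :
  {in Z &, forall x y, x != y -> ~~ knn_graph k x y} ->
  (#|[set x in Z | is_knn k x z]| <= 8)%N.
Proof.
move=> Zind; set A := [set x in _ | _].
have inj : {in A &, injective (fun x : X => octant (val z) (val x))}.
  move=> x y; rewrite !inE => /andP[xZ xz] /andP[yZ yz].
  move=> /octant_dist.
  apply: contraPeq => xy; apply/negP.
  have := Zind x y xZ yZ xy; rewrite /knn_graph negb_or => /andP[nxy nyx].
  have yx : y != x by rewrite eq_sym.
  (* Non-adjacency puts [z] strictly closer than [y] to [x], and strictly closer than [x] to [y],
     against [octant_dist]. *)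
  have := knn_closer yx nxy xz; have := knn_closer xy nyx yz.
  by rewrite (sqdistC (val y) (val x)) !ltNge negb_or => -> ->.
have -> : 8%N = #|{: bool * bool * bool}| by rewrite !card_prod card_bool.
by rewrite -(card_in_imset inj) max_card.
Qed.

Lemma sum_mem_card (T : finType) (A : {set T}) (P : pred T) :
  (\sum_(y in A) (P y : nat) = #|[set y in A | P y]|)%N.
Proof.
by rewrite -sum1dep_card big_mkcondr; apply: eq_bigr => y _; case: (P y).
Qed.

(** Double counting of the directed edges from [Z] to [W]: each vertex of [W] receives at most 8 of
    them. A vertex of [Z] sends at least [k], since it is not joined to the other vertices of
    [Z]. *)
Lemma knn_independent_card (R : realType) (k : nat) (X : {fset R * R})
    (Z W : {set X}) :
  {in Z &, forall x y, x != y -> ~~ knn_graph k x y} ->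
  (forall x y, x \in Z -> is_knn k x y -> y \in W) ->
  (#|Z| <= 1)%N \/ (k * #|Z| <= 8 * #|W|)%N.
Proof.
move=> Zind ZW; have [|Z1] := leqP #|Z| 1; [by left | right].
have kZ x : x \in Z -> (k <= \sum_(y in W) is_knn k x y)%N.
  move=> xZ; rewrite sum_mem_card.
  have [/leq_trans|xall] := knn_card k x.
    apply; apply: subset_leq_card; apply/fintype.subsetP => y; rewrite !inE.
    by move=> xy; apply/andP; split; [exact: ZW xy|].
  have [y] : exists y, y \in Z :\ x.
    by apply/finset.set0Pn; rewrite -card_gt0; move: Z1; rewrite (cardsD1 x) xZ; lia.
  rewrite !inE => /andP[yx yZ].
  have := Zind x y xZ yZ; rewrite eq_sym yx => /(_ isT).
  by rewrite /knn_graph xall.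
rewrite mulnC -sum_nat_const (leq_trans (leq_sum _ kZ)) // exchange_big /=.
rewrite mulnC -sum_nat_const; apply: leq_sum => y _.
by rewrite sum_mem_card; exact: knn_independent_indegree.
Qed.

(** * Grids of cells *)

Definition cell (R : realType) (s : R) (p : R * R) : nat * nat :=
  (Num.truncn (p.1 / s), Num.truncn (p.2 / s)).

(** Directions are booleans, [~~ d] being the one orthogonal to [d], so that arguments for rows and
    columns are made once. *)
Definition coord (d : bool) (c : nat * nat) : nat := if d then c.1 else c.2.

Definition box (i j a b : nat) : pred (nat * nat) :=
  [pred c | (i <= c.1 < i + a)%N && (j <= c.2 < j + b)%N].

(** With truncated subtraction at most one summand is nonzero: this is the number of indices
    strictly between [i] and [j]. *)
Definition gap (i j : nat) : nat := ((i - j.+1) + (j - i.+1))%N.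

(* The cells at distance less than [sqrt 5] times the side length from [c]:
   points of two cells sharing an edge are closer than that. *)
Definition cell_ball (c : nat * nat) : pred (nat * nat) :=
  [pred c' | (gap c.1 c'.1 ^ 2 + gap c.2 c'.2 ^ 2 < 5)%N].

Definition in_cells (R : realType) (s : R) (X : {fset R * R})
    (A : pred (nat * nat)) : {set X} := [set x | A (cell s (val x))].

Lemma trunc_divP (R : realType) (s t : R) : 0 < s -> 0 <= t ->
  (Num.truncn (t / s))%:R * s <= t < (Num.truncn (t / s)).+1%:R * s.
Proof.
move=> s0 t0; have : 0 <= t / s by rewrite divr_ge0 // ltW.
by move=> /truncn_itv; rewrite ler_pdivlMr // ltr_pdivrMr.
Qed.

Lemma trunc_div_ub (R : realType) (s t u : R) (a : nat) :
  0 < s -> 0 <= t -> 0 <= u -> `|t - u| < a%:R * s ->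
  (Num.truncn (u / s) <= Num.truncn (t / s) + a)%N.
Proof.
move=> s0 t0 u0; have := trunc_divP s0 t0; have := trunc_divP s0 u0.
move: (Num.truncn _) (Num.truncn _) => j i /andP[iu _] /andP[_ tj] tu.
rewrite leqNgt; apply/negP => ji.
have : (j + a)%N.+1%:R * s <= i%:R * s by rewrite ler_pM2r // ler_nat.
rewrite -addSn natrD mulrDl; move: tu; rewrite ltr_norml => /andP[+ _].
by lra.
Qed.

Lemma trunc_div_dist (R : realType) (s t u : R) (a : nat) :
  0 < s -> 0 <= t -> 0 <= u ->
  (Num.truncn (u / s) <= Num.truncn (t / s) + a)%N ->
  (Num.truncn (t / s) <= Num.truncn (u / s) + a)%N ->
  `|t - u| < a.+1%:R * s.
Proof.
move=> s0 t0 u0; have := trunc_divP s0 t0; have := trunc_divP s0 u0.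
move: (Num.truncn _) (Num.truncn _) => j i /andP[iu ui] /andP[jt tj] ij ji.
have : i%:R * s <= (j + a)%N%:R * s by rewrite ler_pM2r // ler_nat.
have : j%:R * s <= (i + a)%N%:R * s by rewrite ler_pM2r // ler_nat.
move: ui tj; rewrite -!(addn1 i) -!(addn1 j) -(addn1 a) !natrD !mulrDl ltr_norml.
by move=> *; apply/andP; split; lra.
Qed.

Lemma trunc_div_gap (R : realType) (s t u : R) :
  0 < s -> 0 <= t -> 0 <= u ->
  (gap (Num.truncn (t / s)) (Num.truncn (u / s)))%:R * s <= `|t - u|.
Proof.
move=> s0 t0 u0; have := trunc_divP s0 t0; have := trunc_divP s0 u0.
rewrite /gap.
move: (Num.truncn _) (Num.truncn _) => j i /andP[iu ui] /andP[jt tj].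
have [ij|ij] := leqP i j.
  have -> : (i - j.+1 = 0)%N by lia.
  have [->|E] : (j - i.+1 = 0)%N \/ (j = i.+1 + (j - i.+1))%N by lia.
    by rewrite mul0r.
  move: jt; rewrite {1}E natrD mulrDl addn0 => jt.
  by rewrite ler_normr; apply/orP; left; lra.
have -> : (j - i.+1 = 0)%N by lia.
have E : (i = j.+1 + (i - j.+1))%N by lia.
move: iu; rewrite {1}E natrD mulrDl add0n => iu.
by rewrite ler_normr; apply/orP; right; lra.
Qed.

Lemma sqr_norm_le (R : realDomainType) (x y : R) :
  0 <= y -> (y <= `|x|) = (y ^+ 2 <= x ^+ 2).
Proof.
by move=> y0; rewrite -[x ^+ 2]real_normK ?num_real // ler_sqr ?nnegrE.
Qed.

Lemma sqr_norm_lt (R : realDomainType) (x y : R) :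
  0 <= y -> (`|x| < y) = (x ^+ 2 < y ^+ 2).
Proof. by move=> y0; rewrite !ltNge sqr_norm_le. Qed.

Lemma cell_ball_near (R : realType) (s : R) (p q : R * R) :
  0 < s -> 0 <= p.1 -> 0 <= p.2 -> 0 <= q.1 -> 0 <= q.2 ->
  sqdist p q < 5 * s ^+ 2 -> cell_ball (cell s p) (cell s q).
Proof.
move=> s0 p1 p2 q1 q2 pq; rewrite /cell_ball /= -(ltr_nat R) natrD !natrX.
rewrite -(ltr_pM2r (exprn_gt0 2 s0)) mulrDl -!exprMn; apply: le_lt_trans pq.
by apply: lerD; rewrite -sqr_norm_le ?trunc_div_gap // mulr_ge0 ?ler0n ?ltW.
Qed.

(** A cell is adjacent to itself in this sense, so that points of a common cell are covered too. *)
Definition cell_adj (c c' : nat * nat) : Prop :=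
  exists d, coord d c = coord d c' /\
    (coord (~~ d) c <= coord (~~ d) c' + 1)%N /\
    (coord (~~ d) c' <= coord (~~ d) c + 1)%N.

(** The two cells fit into a rectangle of sides [s] and [2 * s], whose squared diagonal is
    [5 * s ^+ 2]. *)
Lemma cell_adj_sqdist (R : realType) (s : R) (p q : R * R) :
  0 < s -> 0 <= p.1 -> 0 <= p.2 -> 0 <= q.1 -> 0 <= q.2 ->
  cell_adj (cell s p) (cell s q) -> sqdist p q < 5 * s ^+ 2.
Proof.
move=> s0 p1 p2 q1 q2 [d [e [le1 le2]]].
have S (t u : R) a : 0 <= t -> 0 <= u ->
    (Num.truncn (u / s) <= Num.truncn (t / s) + a)%N ->
    (Num.truncn (t / s) <= Num.truncn (u / s) + a)%N ->
    (t - u) ^+ 2 < a.+1%:R ^+ 2 * s ^+ 2.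
  move=> t0 u0 h1 h2; rewrite -exprMn -sqr_norm_lt ?trunc_div_dist //.
  by rewrite mulr_ge0 ?ltW.
rewrite /sqdist; case: d e le1 le2 => /= e le1 le2.
  have := S p.1 q.1 0 p1 q1; have := S p.2 q.2 1 p2 q2 le2 le1.
  by rewrite e addn0 leqnn => h1 /(_ isT isT) h2; lra.
have := S p.2 q.2 0 p2 q2; have := S p.1 q.1 1 p1 q1 le2 le1.
by rewrite e addn0 leqnn => h1 /(_ isT isT) h2; lra.
Qed.

Definition good_cell (R : realType) (kappa k : nat) (s : R) (X : {fset R * R})
    (c : nat * nat) : bool :=
  (kappa <= #|in_cells s X (pred1 c)|)%N && (#|in_cells s X (cell_ball c)| <= k)%N.

Definition in_grid (R : realType) (s : R) (M : nat) (X : {fset R * R}) : Prop :=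
  forall p, p \in X -> [&& 0 <= p.1, 0 <= p.2, p.1 < M%:R * s & p.2 < M%:R * s].

Lemma in_grid_cell (R : realType) (s : R) (M : nat) (X : {fset R * R}) (x : X)
    (d : bool) :
  0 < s -> in_grid s M X -> (coord d (cell s (val x)) < M)%N.
Proof.
move=> s0 /(_ _ (valP x))/and4P[x1 x2 x3 x4].
by case: d; rewrite /= truncn_lt_nat ?divr_ge0 ?(ltW s0) // ltr_pdivrMr.
Qed.

(** Points closer to [x] than [y] lie in the ball of the cell of [x]. So does [x] itself, which is
    not counted among them, hence there are fewer than [k]. *)
Lemma good_cell_adj (R : realType) (kappa k M : nat) (s : R) (X : {fset R * R})
    (x y : X) :
  0 < s -> in_grid s M X -> good_cell kappa k s X (cell s (val x)) ->
  cell_adj (cell s (val x)) (cell s (val y)) -> y != x -> knn_graph k x y.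
Proof.
move=> s0 gX /andP[_ ck] xy yx; rewrite /knn_graph is_knnE yx /=; apply/orP; left.
have /and4P[x1 x2 _ _] := gX _ (valP x); have /and4P[y1 y2 _ _] := gX _ (valP y).
have d5 := cell_adj_sqdist s0 x1 x2 y1 y2 xy.
apply: leq_trans ck; apply: proper_card; apply/properP; split.
  apply/fintype.subsetP => z; rewrite !inE => /andP[_ zy].
  have /and4P[z1 z2 _ _] := gX _ (valP z).
  by apply: cell_ball_near => //; exact: lt_trans zy d5.
exists x; rewrite !inE ?eqxx //.
by apply: cell_ball_near => //; rewrite /sqdist !subrr expr0n addr0 mulr_gt0 ?exprn_gt0.
Qed.

Lemma short_edge (R : realType) (k M q : nat) (s : R) (X : {fset R * R}) (x y : X) :
  0 < s -> in_grid s M X -> (0 < q <= M)%N ->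
  (forall i j, (i + q <= M)%N -> (j + q <= M)%N ->
     (k < #|in_cells s X (box i j q q)|)%N) ->
  is_knn k x y -> sqdist (val x) (val y) < 2 * (q%:R * s) ^+ 2.
Proof.
move=> s0 gX /andP[q0 qM] long; rewrite is_knnE => /andP[yx xyk].
have [i [j [iM jM xij]]] : exists i j, [/\ (i + q <= M)%N, (j + q <= M)%N &
    box i j q q (cell s (val x))].
  have := in_grid_cell x true s0 gX; have := in_grid_cell x false s0 gX.
  move: (cell s (val x)) => [a b] /= h2 h1.
  (* Near the far sides the block is shifted back into the grid. *)
  exists (minn a (M - q)), (minn b (M - q)).
  split; [lia|lia|apply/andP; split=> /=; lia].
rewrite ltNge; apply/negP => dxy.
have := long i j iM jM; rewrite ltnNge => /negP; apply.
apply: leq_trans xyk; rewrite -[X in (_ <= X)%N]add1n.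
rewrite (cardsD1 x) inE xij leq_add2l; apply: subset_leq_card.
apply/fintype.subsetP => z; rewrite !inE => /andP[-> zij] /=; apply: lt_le_trans dxy.
have /and4P[x1 x2 _ _] := gX _ (valP x); have /and4P[z1 z2 _ _] := gX _ (valP z).
have S (t u : R) : 0 <= t -> 0 <= u ->
    (Num.truncn (u / s) <= Num.truncn (t / s) + q.-1)%N ->
    (Num.truncn (t / s) <= Num.truncn (u / s) + q.-1)%N ->
    (t - u) ^+ 2 < (q%:R * s) ^+ 2.
  move=> t0 u0 h1 h2; rewrite -sqr_norm_lt ?mulr_ge0 ?ler0n ?(ltW s0) //.
  by rewrite -(prednK q0) trunc_div_dist.
move: xij zij; rewrite /box /cell /= => /andP[xi xj] /andP[zi zj].
have h1 : ((val x).1 - (val z).1) ^+ 2 < (q%:R * s) ^+ 2.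
  by apply: S x1 z1 _ _; move: xi zi q0; clear; move: (Num.truncn _) (Num.truncn _); lia.
have h2 : ((val x).2 - (val z).2) ^+ 2 < (q%:R * s) ^+ 2.
  by apply: S x2 z2 _ _; move: xj zj q0; clear; move: (Num.truncn _) (Num.truncn _); lia.
by rewrite /sqdist mulr_natl mulr2n ltrD.
Qed.

(** * Frames of good cells *)

Definition mk_cell (d : bool) (t a : nat) : nat * nat := if d then (t, a) else (a, t).

Lemma coord_mk (d : bool) (t a : nat) : coord d (mk_cell d t a) = t.
Proof. by case: d. Qed.

Lemma coord_mkN (d : bool) (t a : nat) : coord (~~ d) (mk_cell d t a) = a.
Proof. by case: d. Qed.

Definition in_range (lo hi : bool -> nat) (c : nat * nat) : bool :=
  [forall d, lo d <= coord d c < hi d]%N.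

Lemma in_range_mk (lo hi : bool -> nat) (d : bool) (t a : nat) :
  in_range lo hi (mk_cell d t a) =
  (lo d <= t < hi d)%N && (lo (~~ d) <= a < hi (~~ d))%N.
Proof.
apply/forallP/andP => [H|[H1 H2] d'].
  by have := H d; have := H (~~ d); rewrite coord_mk coord_mkN.
by case: d d' H1 H2 => -[].
Qed.

(* The good cells between the two rectangles form a frame that no edge jumps
   over and that stays connected after the removal of fewer than [kappa]
   vertices. Sides with [lo d = 0] or [hi d = M] lie on the boundary of the grid
   and need no frame. *)
Lemma frame_connect (V : finType) (e : rel V) (kappa M f : nat)
    (cl : V -> nat * nat) (good : pred (nat * nat)) (lo hi lo' hi' : bool -> nat) :
  symmetric e -> kappa_connected kappa e -> (0 < f)%N ->
  (forall v d, (coord d (cl v) < M)%N) ->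
  (forall u v d, e u v -> (coord d (cl v) <= coord d (cl u) + f)%N) ->
  (forall u v, good (cl u) -> cell_adj (cl u) (cl v) -> v != u -> e u v) ->
  (forall c, good c -> (kappa <= #|[set v | cl v == c]|)%N) ->
  (forall d, [/\ lo' d <= lo d, lo d < hi d & hi d <= hi' d]%N) ->
  (forall d, lo d = 0%N \/ (lo' d + f)%N = lo d) ->
  (forall d, (hi d = M /\ hi' d = M) \/ (hi d + f)%N = hi' d) ->
  (forall d, ~ (lo d = 0%N /\ hi d = M)) ->
  (forall c, in_range lo' hi' c -> ~~ in_range lo hi c -> good c) ->
  let Q := [set v | in_range lo' hi' (cl v)] in
  (forall x u, in_range lo hi (cl x) -> e x u -> u \in Q) /\
  (forall S : {set V}, (#|S| < kappa)%N ->
   forall u w, u \in Q :\: S -> w \in Q :\: S ->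
     connect (induced e (Q :\: S)) u w).
Proof.
move=> esym [_ kconn] f0 gridM short adj pop ends lo0 hiM side frameP Q.
have inQ v : (v \in Q) = in_range lo' hi' (cl v) by rewrite inE.
have nojump x u : in_range lo hi (cl x) -> e x u -> u \in Q.
  move=> /forallP xin xu; rewrite inQ; apply/forallP => d.
  have := xin d; have := short _ _ d xu; have := gridM u d.
  have := short u x d (etrans (esym _ _) xu).
  by have [] := ends d; have := lo0 d; have := hiM d; clear; lia.
split=> // S Sk.
set A := Q :\: S.
have inA v : (v \in A) = (v \notin S) && in_range lo' hi' (cl v).
  by rewrite finset.in_setD inQ.
pose frame c := in_range lo' hi' c && ~~ in_range lo hi c.
have frame_good c : frame c -> good c by move=> /andP[]; exact: frameP.
(* A good cell has at least [kappa] points, so one of them survives the removal of [S]. *)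
have rep c : frame c -> exists2 r, cl r = c & r \notin S.
  move=> /frame_good/pop; set B := [set v | _] => kB.
  have /fintype.subsetPn[r] : ~~ (B \subset S).
    apply/negP => /subset_leq_card BS.
    by have := leq_ltn_trans (leq_trans kB BS) Sk; rewrite ltnn.
  by rewrite inE => /eqP rc rS; exists r.
pose L c c' := forall p p', p \notin S -> p' \notin S -> cl p = c -> cl p' = c' ->
  connect (induced e A) p p'.
have L_sym c c' : L c c' -> L c' c.
  by move=> Lc p p' pS p'S pc p'c; rewrite (induced_connect_sym _ esym) Lc.
have L_trans c c' c'' : frame c' -> L c c' -> L c' c'' -> L c c''.
  move=> /rep[r rc rS] L1 L2 p p' pS p'S pc p'c.
  exact: connect_trans (L1 _ _ pS rS pc rc) (L2 _ _ rS p'S rc p'c).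
have L_adj c c' : frame c -> frame c' -> cell_adj c c' -> L c c'.
  move=> fc fc' cc' p p' pS p'S pc p'c.
  have [->|p'p] := eqVneq p' p; first exact: connect0.
  apply: connect1; rewrite /induced !inA pS p'S pc p'c.
  have [/andP[-> _] /andP[-> _]] := (fc, fc'); rewrite /=.
  by apply: adj => //; rewrite pc ?p'c //; exact: frame_good.
have line d t a b : (lo' d <= t < hi' d)%N -> ~~ (lo d <= t < hi d)%N ->
    (lo' (~~ d) <= a < hi' (~~ d))%N -> (lo' (~~ d) <= b < hi' (~~ d))%N ->
    L (mk_cell d t a) (mk_cell d t b).
  move=> tin tout.
  wlog ab : a b / (a <= b)%N.
    move=> wl; have [ab|/ltnW ba] := leqP a b; first exact: wl.
    by move=> ain bin; apply: L_sym; apply: wl.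
  move=> ain; rewrite -(subnKC ab); elim: (b - a)%N => [|n IHn] bin.
    rewrite addn0; apply: L_adj; rewrite /frame ?in_range_mk ?tin ?ain ?(negPf tout) //.
    by exists true; split=> //; rewrite leq_addr.
  have bin' : (lo' (~~ d) <= a + n < hi' (~~ d))%N by move: ain bin; clear; lia.
  have fr : frame (mk_cell d t (a + n)%N).
    by rewrite /frame !in_range_mk tin bin' (negPf tout).
  apply: (L_trans _ _ _ fr (IHn bin')); apply: (L_adj _ _ fr).
    by rewrite /frame !in_range_mk tin bin (negPf tout).
  by exists d; rewrite !coord_mk !coord_mkN; split=> //; clear; lia.
(* In each direction some side of the rectangle is framed; [t0 d] is the coordinate of a line inside
   that part of the frame. *)
have [t0 t0P] : exists t0 : bool -> nat, forall d,
    (lo' d <= t0 d < hi' d)%N /\ ~~ (lo d <= t0 d < hi d)%N.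
  exists (fun d => if lo d == 0 then hi d else lo' d) => d.
  have [] := ends d; have := lo0 d; have := hiM d; have := side d.
  by case: eqP => ld; move: ld f0; clear; lia.
pose base := mk_cell true (t0 true) (t0 false).
have [t1 t1o] := t0P true; have [t2 t2o] := t0P false.
have baseE : base = mk_cell false (t0 false) (t0 true) by [].
have L_base c : frame c -> L c base.
  move=> /[dup] fc /andP[/forallP cin].
  have c1 := cin true; have c2 := cin false.
  rewrite negb_forall => /existsP[[] /= cout].
    have -> : c = mk_cell true (coord true c) (coord false c) by case: (c).
    apply: (@L_trans _ (mk_cell true (coord true c) (t0 false))).
    - by rewrite /frame !in_range_mk c1 t2 /= (negPf cout).
    - exact: line.
    - by rewrite baseE; apply: (line false).
  have -> : c = mk_cell false (coord false c) (coord true c) by case: (c).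
  apply: (@L_trans _ (mk_cell false (coord false c) (t0 true))).
  - by rewrite /frame !in_range_mk c2 t1 /= (negPf cout).
  - exact: line.
  - by apply: (line true).
have fbase : frame base by rewrite /frame !in_range_mk t1 t2 (negPf t1o).
have [r rb rS] := rep _ fbase.
(* A path from [u] to [r] in the whole graph minus [S] is followed until it first meets the frame.
   Up to that point it cannot leave [Q], as no edge jumps over the frame. *)
have reach u : u \in A -> connect (induced e A) u r.
  move=> uA; have uS : u \notin S by move: uA; rewrite inA => /andP[].
  have /connectP[p] := kconn S Sk u r uS rS.
  elim: p u uA {uS} => [|v p IHp] u uA /=.
    by move=> _ ->; exact: connect0.
  move=> /andP[/and3P[uS vS uv] pv] rE.
  have [ufr|ufr] := boolP (frame (cl u)).
    exact: L_base ufr u r uS rS erefl rb.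
  have vA : v \in A.
    rewrite /A finset.in_setD vS; apply: nojump uv.
    by move: uA ufr; rewrite inA /frame => /andP[_ ->]; rewrite negbK.
  apply: connect_trans (IHp v vA pv rE); apply: connect1.
  by rewrite /induced uA vA.
move=> u w uA wA; apply: connect_trans (reach u uA) _.
by rewrite (induced_connect_sym _ esym) reach.
Qed.

(* [lo] and [hi] delimit the maximal run of bad strips around [i0]; [i0] itself
   may be good. *)
Lemma good_strips (bad : pred nat) (I J i0 : nat) :
  (i0 < I)%N ->
  (forall g : 'I_J -> nat, injective g ->
     (forall j, (g j < I)%N /\ (i0 - J <= g j <= i0 + J)%N) ->
     exists j, ~~ bad (g j)) ->
  exists lo hi, [/\ (lo <= i0 < hi)%N, (hi <= I)%N, (hi <= lo + J)%N,
    lo = 0%N \/ ~~ bad lo.-1 & hi = I \/ ~~ bad hi].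
Proof.
move=> i0I few.
pose Pl l := (l <= i0)%N && all bad (iota l (i0 - l)).
pose Ph h := (i0 < h <= I)%N && all bad (iota i0.+1 (h - i0.+1)).
have exl : exists l, Pl l by exists i0; rewrite /Pl leqnn subnn.
have exh : exists h, Ph h by exists i0.+1; rewrite /Ph subnn leqnn i0I.
have ubh h : Ph h -> (h <= I)%N by move=> /andP[/andP[]].
have [lo /andP[loi /allP lobad] lomin] := ex_minnP exl.
have [hi /andP[/andP[ihi hiI] /allP hibad] himax] := ex_maxnP exh ubh.
have bad_in v : (lo <= v < hi)%N -> v != i0 -> bad v.
  move=> v1 v0; have [vi|iv] := ltnP v i0.
    by apply: lobad; rewrite mem_iota; lia.
  by apply: hibad; rewrite mem_iota; lia.
exists lo, hi; split; rewrite ?loi ?ihi //; last first.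
- have [->|hiI'] := eqVneq hi I; [by left|right; apply/negP => badhi].
  suff /himax : Ph hi.+1 by rewrite ltnn.
  apply/andP; split; first by lia.
  apply/allP => v; rewrite mem_iota => vin.
  have [->//|vhi] := eqVneq v hi.
  by apply: hibad; rewrite mem_iota; lia.
- case: (posnP lo) => [->|lo0]; [by left|right; apply/negP => badlo].
  suff /lomin : Pl lo.-1 by lia.
  apply/andP; split; first by lia.
  apply/allP => v; rewrite mem_iota => vin.
  have [->//|vlo] := eqVneq v lo.-1.
  by apply: lobad; rewrite mem_iota; lia.
rewrite leqNgt; apply/negP => Jhi.
(* A run longer than [J] contains [J] bad strips other than [i0] within distance [J] of [i0]; [g]
   lists such strips in order, skipping [i0]. *)
pose lo2 := maxn lo (i0 - J).
pose g (j : 'I_J) := if (lo2 + j < i0)%N then (lo2 + j)%N else (lo2 + j).+1.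
have [j|j|j] := few g.
- move=> j' jj; apply/val_inj => /=; move: jj; rewrite /g.
  by case: ifP; case: ifP; lia.
- by have := ltn_ord j; rewrite /g /lo2; case: ifP; lia.
move=> /negP; apply; have := ltn_ord j.
by rewrite /g /lo2 => jJ; apply: bad_in; case: ifP; lia.
Qed.

Lemma strip_coord (v c : nat) :
  (40 * v + 3 <= c < 40 * v + 37)%N ->
  (c %/ 40 = v)%N /\ (3 <= c %% 40 < 37)%N.
Proof. by move=> ?; split; lia. Qed.

(** The diagonal of a block of 24 by 24 cells is shorter than 34 cells, as
    [2 * 24 ^ 2 = 1152 <= 34 ^ 2 = 1156]. A strip of width 40 minus the margins of 3 on both sides
    has exactly this width 34, so edges cannot jump over it. *)
Lemma short_edge_coord (R : realType) (k M : nat) (s : R) (X : {fset R * R})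
    (x y : X) (d : bool) :
  0 < s -> in_grid s M X -> (24 <= M)%N ->
  (forall i j, (i + 24 <= M)%N -> (j + 24 <= M)%N ->
     (k < #|in_cells s X (box i j 24 24)|)%N) ->
  knn_graph k x y ->
  (coord d (cell s (val y)) <= coord d (cell s (val x)) + 34)%N.
Proof.
move=> s0 gX M24 long xy.
have {xy} dxy : sqdist (val x) (val y) < (34%:R * s) ^+ 2.
  have : 2 * (24%:R * s) ^+ 2 <= (34%:R * s) ^+ 2.
    by rewrite !exprMn mulrA ler_pM2r ?exprn_gt0 // -!natrX -natrM ler_nat.
  apply: lt_le_trans; case/orP: xy => /(short_edge s0 gX); first exact.
  by rewrite sqdistC; exact.
have /and4P[x1 x2 _ _] := gX _ (valP x); have /and4P[y1 y2 _ _] := gX _ (valP y).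
have s34 : 0 <= 34%:R * s by rewrite mulr_ge0 ?ler0n ?(ltW s0).
case: d; apply: trunc_div_ub => //; rewrite sqr_norm_lt //; apply: le_lt_trans dxy.
  by rewrite lerDl sqr_ge0.
by rewrite lerDr sqr_ge0.
Qed.

(* The three rows or columns next to the border of a strip are disregarded, so
   that the balls of the remaining cells of a strip lie in that strip. *)
Definition few_bad_strips (R : realType) (kappa k J M : nat) (s : R)
    (X : {fset R * R}) : Prop :=
  forall (d : bool) (i0 : bool -> nat) (c : 'I_J -> nat * nat),
    (forall d', (40 * i0 d' < M)%N) ->
    (forall j, (forall d', (coord d' (c j) < M)%N /\
       (40 * (i0 d' - J) <= coord d' (c j) < 40 * (i0 d' + J + 1))%N) /\
       (3 <= coord d (c j) %% 40 < 37)%N) ->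
    injective (fun j => (coord d (c j) %/ 40)%N) ->
    exists j, good_cell kappa k s X (c j).

(** The deterministic half of the dense regime. The bound on windows of side [K] is the one that
    turns the double counting into at most [kappa] independent vertices. [K] leaves room for [J]
    strips, two frame strips, and twice the edge reach 34 on either side. *)
Lemma grid_hamiltonian (R : realType) (kappa k J I K : nat) (s : R)
    (X : {fset R * R}) :
  0 < s -> in_grid s (40 * I)%N X -> (1 < kappa)%N -> (0 < k)%N ->
  (40 * (J + 2) + 136 <= K)%N ->
  (forall i j, (i < 40 * I)%N -> (j < 40 * I)%N ->
     (8 * #|in_cells s X (box i j K K)| <= kappa * k)%N) ->
  ((J < I)%N ->
     (forall i j, (i + 24 <= 40 * I)%N -> (j + 24 <= 40 * I)%N ->
       (k < #|in_cells s X (box i j 24 24)|)%N) /\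
     few_bad_strips kappa k J (40 * I)%N s X) ->
  kappa_connected kappa (@knn_graph R k X) -> hamiltonian (@knn_graph R k X).
Proof.
move=> s0 gX kappa1 k0 JK win frames kconn.
have [_ kconn'] := kconn.
have esym := @knn_graphC R k X.
have indep (Z : {set X}) i j : (i < 40 * I)%N -> (j < 40 * I)%N ->
    {in Z &, forall y z, y != z -> ~~ knn_graph k y z} ->
    (forall x y, x \in Z -> is_knn k x y -> y \in in_cells s X (box i j K K)) ->
    (#|Z| <= kappa)%N.
  move=> iI jI Zind /(knn_independent_card Zind)[|/leq_trans/(_ (win i j iI jI))].
    by move=> /leq_trans; apply; exact: ltnW.
  by rewrite mulnC leq_pmul2r.
suff /choice[Q QP] : forall x : X, exists Q : {set X},
  [/\ forall y, (y == x) || knn_graph k x y -> y \in Q,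
      forall S : {set X}, (#|S| < kappa)%N ->
        forall u w, knn_graph k x u -> knn_graph k x w -> u \notin S -> w \notin S ->
        connect (induced (@knn_graph R k X) (Q :\: S)) u w &
      forall Z : {set X},
        (forall z, z \in Z -> exists2 y, y \in Q & (z == y) || knn_graph k y z) ->
        {in Z &, forall y z, y != z -> ~~ knn_graph k y z} -> (#|Z| <= kappa)%N].
  apply: (local_chvatal_erdos (Q := Q) esym kappa1 kconn) => [x|x|x|].
  - by have [] := QP x.
  - by have [] := QP x.
  - by have [] := QP x.
  - exact: knn_graph_irr.
move=> x; have gM y d := in_grid_cell y d s0 gX.
have I0 : (0 < 40 * I)%N by have := gM x true; lia.
have [IJ|JI] := leqP I J.
  (* With at most [J] strips the whole square fits into one window, and global connectivity replaces
     the frame. *)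
  exists [set: X]; split=> [y _|S Sk u w _ _ uS wS|Z _ Zind].
  - by rewrite inE.
  - have := kconn' S Sk u w uS wS; apply: connect_sub => a b /and3P[aS bS ab].
    by apply: connect1; rewrite /induced !inE aS bS.
  - apply: (indep Z 0%N 0%N) => // a b _ _; rewrite inE /box /= !add0n.
    by have := gM b true; have := gM b false; rewrite /=; lia.
have {frames} [long few] := frames JI.
have short (u v : X) d : knn_graph k u v ->
    (coord d (cell s (val v)) <= coord d (cell s (val u)) + 34)%N.
  by move=> uv; apply: (short_edge_coord d s0 gX _ long uv); move: JI; clear; lia.
pose i0 d := (coord d (cell s (val x)) %/ 40)%N.
have i0I d : (i0 d < I)%N by have := gM x d; rewrite /i0; lia.
(* Badness is relative to [x]: only cells within [J] strips of [x] in both directions matter, which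
   keeps the number of configurations per position bounded. *)
pose bad d v := ~~ `[< forall c, (forall d', (coord d' c < 40 * I)%N /\
   (40 * (i0 d' - J) <= coord d' c < 40 * (i0 d' + J + 1))%N) ->
   (3 <= coord d c %% 40 < 37)%N -> (coord d c %/ 40)%N = v ->
   good_cell kappa k s X c >].
have strips d : exists p : nat * nat, [/\ (p.1 <= i0 d < p.2)%N, (p.2 <= I)%N,
    (p.2 <= p.1 + J)%N, p.1 = 0%N \/ ~~ bad d p.1.-1 & p.2 = I \/ ~~ bad d p.2].
  have [g ginj gin|lo [hi H]] := @good_strips (bad d) I J (i0 d) (i0I d); last first.
    by exists (lo, hi).
  apply: contrapT => nob.
  have gbad j : bad d (g j) by apply: contrapT => /negP gj; apply: nob; exists j.
  have /choice[c cP] : forall j, exists c, [/\ (forall d', (coord d' c < 40 * I)%N /\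
      (40 * (i0 d' - J) <= coord d' c < 40 * (i0 d' + J + 1))%N),
      (3 <= coord d c %% 40 < 37)%N, (coord d c %/ 40)%N = g j &
      ~ good_cell kappa k s X c].
    move=> j; have /asboolPn/existsNP[c] := gbad j.
    by move=> /not_implyP[? /not_implyP[? /not_implyP[? ?]]]; exists c; split.
  have [|||j] := few d i0 c.
  - by move=> d'; have := i0I d'; lia.
  - by move=> j; have [h1 h2 _ _] := cP j.
  - by move=> j j' /=; have [_ _ -> _] := cP j; have [_ _ -> _] := cP j' => /ginj.
  - by have [_ _ _ +] := cP j.
have /choice[p pP] := strips.
(* The frame is the trimmed part, of width 34, of the good strips next to the run; their inner
   margins of 3 cells go to the inner rectangle. Sides on the boundary of the grid have no frame. *)
pose lo d := if (p d).1 == 0%N then 0%N else (40 * (p d).1 - 3)%N.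
pose lo' d := if (p d).1 == 0%N then 0%N else (40 * ((p d).1 - 1) + 3)%N.
pose hi d := if (p d).2 == I then (40 * I)%N else (40 * (p d).2 + 3)%N.
pose hi' d := if (p d).2 == I then (40 * I)%N else (40 * (p d).2 + 37)%N.
have win_p d t : (lo' d <= t < hi' d)%N ->
    (t < 40 * I)%N /\ (40 * (i0 d - J) <= t < 40 * (i0 d + J + 1))%N.
  have [] := pP d; rewrite /lo' /hi'; case: eqP; case: eqP; clear; lia.
pose cl (v : X) := cell s (val v).
have gridM v d : (coord d (cl v) < 40 * I)%N by exact: gM.
have adj u v : good_cell kappa k s X (cl u) -> cell_adj (cl u) (cl v) -> v != u ->
    knn_graph k u v by exact: good_cell_adj gX.
have pop c : good_cell kappa k s X c -> (kappa <= #|[set v | cl v == c]|)%N.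
  move=> /andP[/leq_trans + _]; apply; apply: subset_leq_card.
  by apply/fintype.subsetP => v; rewrite !inE.
have ends d : [/\ lo' d <= lo d, lo d < hi d & hi d <= hi' d]%N.
  have [] := pP d; rewrite /lo /lo' /hi /hi'.
  by case: eqP; case: eqP; clear; split; lia.
have lo0 d : lo d = 0%N \/ (lo' d + 34)%N = lo d.
  by rewrite /lo /lo'; case: eqP; clear; lia.
have hiM d : (hi d = (40 * I)%N /\ hi' d = (40 * I)%N) \/ (hi d + 34)%N = hi' d.
  by rewrite /hi /hi'; case: eqP; clear; lia.
have side d : ~ (lo d = 0%N /\ hi d = (40 * I)%N).
  have [] := pP d; rewrite /lo /hi.
  by case: eqP; case: eqP; move: JI; clear; lia.
have frameP c : in_range lo' hi' c -> ~~ in_range lo hi c ->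
    good_cell kappa k s X c.
  move=> /forallP cin; rewrite negb_forall => /existsP[d cout].
  have [p1 p2 p3 lob hib] := pP d.
  have cd := cin d.
  have cw d' := win_p d' _ (cin d').
  have [v [vgood vc]] :
      exists v, ~~ bad d v /\ (40 * v + 3 <= coord d c < 40 * v + 37)%N.
    have [cl1|cl1] := ltnP (coord d c) (lo d).
      exists (p d).1.-1; move: cd cl1; rewrite /lo /lo'; case: eqP => // p0.
      by case: lob => // ->; clear -p0; lia.
    have {}cl1 : (hi d <= coord d c)%N by move: cl1 cout; clear; lia.
    exists (p d).2; move: cd cl1; rewrite /hi /hi'.
    case: eqP => [|p0]; first by clear; lia.
    by case: hib => // ->; clear; lia.
  by have [vd vm] := strip_coord vc; move: vgood; rewrite negbK => /asboolP; exact.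
have [nojump conn] := frame_connect esym kconn (isT : (0 < 34)%N) gridM short adj
  pop ends lo0 hiM side frameP.
have xin : in_range lo hi (cell s (val x)).
  apply/forallP => d; have [+ _ _ _ _] := pP d; rewrite /i0 /lo /hi.
  by have := gM x d; case: eqP; case: eqP; clear; lia.
exists [set v | in_range lo' hi' (cl v)]; split; last first.
- move=> Z ZQ Zind.
  (* The offset 68 is two edges: [Z] may lie one edge outside the rectangle, and its out-neighbours
     one more. *)
  apply: (indep Z (lo' true - 68)%N (lo' false - 68)%N) => //.
  + have [] := pP true; rewrite /lo'; case: eqP; move: I0; clear; lia.
  + have [] := pP false; rewrite /lo'; case: eqP; move: I0; clear; lia.
  move=> z t zZ zt; have [y yQ yz] := ZQ z zZ.
  have B d : (lo' d - 68 <= coord d (cell s (val t)) < lo' d - 68 + K)%N.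
    move: yQ; rewrite inE /cl => /forallP/(_ d) yd.
    have h1 : (coord d (cell s (val z)) <= coord d (cell s (val y)) + 34 /\
               coord d (cell s (val y)) <= coord d (cell s (val z)) + 34)%N.
      case/predU1P: yz => [->|yz]; first by clear; lia.
      by split; apply: short => //; rewrite esym.
    have zt' : knn_graph k z t by rewrite /knn_graph zt.
    have h2 := short z t d zt'; have h3 := short t z d (etrans (esym _ _) zt').
    have [_ + + _ _] := pP d; move: yd h1 h2 h3 JK; rewrite /lo' /hi'.
    move: (coord d _) (coord d _) (coord d _) => cz cy ct.
    by case: eqP; case: eqP; clear; lia.
  by rewrite inE /box /=; have := B true; have := B false; rewrite /= => -> ->.
- move=> S Sk u w xu xw uS wS; apply: conn => //; rewrite finset.in_setD ?uS ?wS.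
    exact: nojump xu.
  exact: nojump xw.
- move=> y /predU1P[->|]; last exact: nojump.
  rewrite inE /cl; apply/forallP => d; have := forallP xin d; have [+ _ _ _ _] := pP d.
  by rewrite /lo /lo' /hi /hi'; case: eqP; case: eqP; clear; lia.
Qed.

(** * Isolated squares *)

Lemma in_cells_box_card (R : realType) (s : R) (X : {fset R * R})
    (i j a b t : nat) :
  (forall c, box i j a.+1 b.+1 c -> (t <= #|in_cells s X (pred1 c)|)%N) ->
  (a.+1 * b.+1 * t <= #|in_cells s X (box i j a.+1 b.+1)|)%N.
Proof.
move=> tc; rewrite -[X in (_ <= X)%N]sum1_card.
pose g (x : X) : 'I_a.+1 * 'I_b.+1 :=
  (inord ((cell s (val x)).1 - i), inord ((cell s (val x)).2 - j)).
rewrite (partition_big g predT) //=.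
rewrite -[X in (X * _ * _)%N]card_ord -[X in (_ * X * _)%N]card_ord -card_prod.
rewrite -sum_nat_const; apply: leq_sum => -[u v] _.
apply: leq_trans (tc (i + u, j + v)%N _) _.
  by rewrite /box /= !leq_addr !ltn_add2l !ltn_ord.
rewrite sum1dep_card subset_leq_card //; apply/fintype.subsetP => x.
rewrite !inE /g => /eqP -> /=.
by rewrite /box /= !leq_addr !ltn_add2l !ltn_ord !addKn !inord_val eqxx.
Qed.

Definition rcoord (R : realType) (d : bool) (p : R * R) : R :=
  if d then p.1 else p.2.

Lemma coord_cell (R : realType) (s : R) (d : bool) (p : R * R) :
  coord d (cell s p) = Num.truncn (rcoord d p / s).
Proof. by case: d. Qed.

Lemma sqdist_rcoord (R : realType) (d : bool) (p q : R * R) :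
  sqdist p q = (rcoord d p - rcoord d q) ^+ 2 +
               (rcoord (~~ d) p - rcoord (~~ d) q) ^+ 2.
Proof. by rewrite /sqdist; case: d => //=; rewrite addrC. Qed.

Lemma trunc_div_itv (R : realType) (s t : R) (i j : nat) : 0 < s -> 0 <= t ->
  (i <= Num.truncn (t / s) < j)%N -> i%:R * s <= t < j%:R * s.
Proof.
move=> s0 t0; have := trunc_divP s0 t0; move: (Num.truncn _) => n.
move=> /andP[nt tn] /andP[i_n n_j]; apply/andP; split.
  by apply: le_trans nt; rewrite ler_pM2r // ler_nat.
by apply: lt_le_trans tn _; rewrite ler_pM2r // ler_nat.
Qed.

(** Here [tp] is beyond the moat and [u] is its distance to the moat. A point in the 7 ring columns
    on that side lies between [tp] and the moat, or else behind [tp] but within those columns; the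
    center is 10 columns past the edge of the moat. *)
Lemma outer_coord (R : realType) (s tp : R) (b : nat) : 0 < s -> 0 <= tp ->
  ~~ (b + 7 <= Num.truncn (tp / s) < b + 34)%N ->
  exists a : nat, exists u : R,
    [/\ 0 <= u, (b <= a)%N /\ (a + 7 <= b + 41)%N,
        (a + 7 <= b + 7)%N \/ (b + 34 <= a)%N,
        forall t : R, 0 <= t -> (a <= Num.truncn (t / s) < a + 7)%N ->
          `|tp - t| <= u \/ `|tp - t| <= 7 * s &
        forall t : R, 0 <= t -> (b + 17 <= Num.truncn (t / s) < b + 24)%N ->
          u + 10 * s <= `|tp - t|].
Proof.
move=> s0 tp0; have [lt7 _|ge7] := ltnP (Num.truncn (tp / s)) (b + 7).
  have /andP[_ tpb] := trunc_div_itv s0 tp0 (lt7 : (0 <= _ < b + 7)%N).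
  exists b, ((b + 7)%N%:R * s - tp); rewrite natrD in tpb *.
  split; first by lra.
  - by rewrite leqnn leq_add2l.
  - by left.
  - move=> t t0 /(trunc_div_itv s0 t0); rewrite natrD => /andP[bt tb].
    have [tpt|ttp] := leP tp t.
      by left; rewrite ler0_norm; lra.
    by right; rewrite ger0_norm; lra.
  - move=> t t0 /(trunc_div_itv s0 t0); rewrite !natrD => /andP[bt tb].
    by rewrite ler_normr; apply/orP; right; lra.
rewrite /= -leqNgt => ge34.
have /andP[tpb _] := trunc_div_itv s0 tp0
  (introT andP (conj ge34 (ltnSn (Num.truncn (tp / s))))).
exists (b + 34)%N, (tp - (b + 34)%N%:R * s); rewrite natrD in tpb *.
split; first by lra.
- by rewrite leq_addr -addnA.
- by right.
- move=> t t0 /(trunc_div_itv s0 t0); rewrite !natrD => /andP[bt tb].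
  have [tpt|ttp] := leP tp t.
    by right; rewrite ler0_norm; lra.
  by left; rewrite ger0_norm; lra.
- move=> t t0 /(trunc_div_itv s0 t0); rewrite !natrD => /andP[bt tb].
  by rewrite ler_normr; apply/orP; left; lra.
Qed.

(** The orthogonal direction, where nothing is known about [tp]: the 13 columns are centered at its
    column clamped to the middle 27, and [v] is its distance to those 27 columns. *)
Lemma inner_coord (R : realType) (s tp : R) (b : nat) : 0 < s -> 0 <= tp ->
  exists r : nat, exists v : R,
    [/\ 0 <= v, (b <= r)%N /\ (r + 13 <= b + 41)%N,
        forall t : R, 0 <= t -> (r <= Num.truncn (t / s) < r + 13)%N ->
          `|tp - t| <= v + 7 * s &
        v = 0 \/ forall t : R, 0 <= t -> (b + 17 <= Num.truncn (t / s) < b + 24)%N ->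
          v + 10 * s <= `|tp - t|].
Proof.
move=> s0 tp0; have [lt7|ge7] := ltnP (Num.truncn (tp / s)) (b + 7).
  have /andP[_ tpb] := trunc_div_itv s0 tp0 (lt7 : (0 <= _ < b + 7)%N).
  exists b.+1, ((b + 7)%N%:R * s - tp); rewrite natrD in tpb *.
  split; first by lra.
  - by rewrite leqnSn addSn -addnS leq_add2l.
  - move=> t t0 /(trunc_div_itv s0 t0); rewrite natrD -natr1 => /andP[bt tb].
    by rewrite ler_norml; apply/andP; split; lra.
  - right=> t t0 /(trunc_div_itv s0 t0); rewrite !natrD => /andP[bt tb].
    by rewrite ler_normr; apply/orP; right; lra.
have [lt34|ge34] := ltnP (Num.truncn (tp / s)) (b + 34).
  exists (Num.truncn (tp / s) - 6)%N, 0; split => //; last by left.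
    by move: ge7 lt34; clear; lia.
  move=> t t0 tin; rewrite add0r ltW //.
  by apply: (@trunc_div_dist _ _ _ _ 6) => //; move: tin ge7; clear; lia.
have /andP[tpb _] := trunc_div_itv s0 tp0
  (introT andP (conj ge34 (ltnSn (Num.truncn (tp / s))))).
exists (b + 27)%N, (tp - (b + 34)%N%:R * s); rewrite natrD in tpb *.
split; first by lra.
- by rewrite leq_addr -addnA leq_add2l.
- move=> t t0 /(trunc_div_itv s0 t0); rewrite !natrD => /andP[bt tb].
  by rewrite ler_norml; apply/andP; split; lra.
- right=> t t0 /(trunc_div_itv s0 t0); rewrite !natrD => /andP[bt tb].
  by rewrite ler_normr; apply/orP; left; lra.
Qed.

(** The tight case is [7 ^ 2 + 7 ^ 2 = 98 < 10 ^ 2]; this is why a moat of width 10 goes with a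
    center and a ring of width 7. *)
Lemma outer_closer (R : realDomainType) (s u v Y1 Y2 Z1 Z2 : R) :
  0 < s -> 0 <= u -> 0 <= v -> `|Y1| <= u \/ `|Y1| <= 7 * s ->
  `|Y2| <= v + 7 * s -> u + 10 * s <= `|Z1| -> v = 0 \/ v + 10 * s <= `|Z2| ->
  Y1 ^+ 2 + Y2 ^+ 2 < Z1 ^+ 2 + Z2 ^+ 2.
Proof.
move=> s0 u0 v0; rewrite -[Y1 ^+ 2]real_normK ?num_real //.
rewrite -[Y2 ^+ 2]real_normK ?num_real // -[Z1 ^+ 2]real_normK ?num_real //.
rewrite -[Z2 ^+ 2]real_normK ?num_real //.
move: `|Y1| `|Y2| `|Z1| `|Z2| (normr_ge0 Y1) (normr_ge0 Y2) (normr_ge0 Z1).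
move=> {Y1 Y2 Z1 Z2} y1 y2 z1 z2 y10 y20 z10 h1 h2 h3 h4.
have sq (a b : R) : 0 <= a -> a <= b -> a ^+ 2 <= b ^+ 2.
  by move=> a0 ab; rewrite ler_sqr ?nnegrE // (le_trans a0).
have z1sq : (u + 10 * s) ^+ 2 <= z1 ^+ 2 by apply: sq => //; lra.
case: h4 => [v00|h4].
  have y2sq : y2 ^+ 2 <= (7 * s) ^+ 2 by apply: sq => //; lra.
  have := sqr_ge0 z2; case: h1 => /(sq _ _ y10) h1; nra.
have y2sq : y2 ^+ 2 <= (v + 7 * s) ^+ 2 by apply: sq.
have z2sq : (v + 10 * s) ^+ 2 <= z2 ^+ 2 by apply: sq => //; lra.
have y1sq : y1 ^+ 2 <= (u + 7 * s) ^+ 2 by apply: sq => //; lra.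
nra.
Qed.

(* The [k] nearest neighbours of a point of the square lie in the square, and a
   point beyond the empty moat has more than [k] points of the full cells closer
   to it than the square. *)
Lemma isolated_square (R : realType) (kappa k t b1 b2 : nat) (s : R)
    (X : {fset R * R}) :
  0 < s -> (forall p, p \in X -> 0 <= p.1 /\ 0 <= p.2) -> (0 < kappa)%N ->
  (k < #|in_cells s X (box (b1 + 17)%N (b2 + 17)%N 7 7)|)%N ->
  (forall x : X, box (b1 + 7)%N (b2 + 7)%N 27 27 (cell s (val x)) ->
     box (b1 + 17)%N (b2 + 17)%N 7 7 (cell s (val x))) ->
  (forall c, box b1 b2 41 41 c -> ~~ box (b1 + 7)%N (b2 + 7)%N 27 27 c ->
     (t <= #|in_cells s X (pred1 c)|)%N) ->
  (k < 91 * t)%N ->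
  ~ kappa_connected kappa (@knn_graph R k X).
Proof.
move=> s0 X0 kappa0 kZ empty ring kt [_ conn].
set Z := in_cells s X (box (b1 + 17)%N (b2 + 17)%N 7 7) in kZ.
pose b d := if d then b1 else b2.
have ge0 (x : X) d : 0 <= rcoord d (val x).
  by have [] := X0 _ (valP x); case: d.
have ZP z d : z \in Z -> (b d + 17 <= Num.truncn (rcoord d (val z) / s) < b d + 24)%N.
  by rewrite inE /box /= => /andP[]; case: d => /=; clear; lia.
have gapP p : p \notin Z ->
    exists d, ~~ (b d + 7 <= Num.truncn (rcoord d (val p) / s) < b d + 34)%N.
  move=> pZ; have : ~~ box (b1 + 7)%N (b2 + 7)%N 27 27 (cell s (val p)).
    by apply: contra pZ => /empty; rewrite inE.
  rewrite /box /= negb_and => /orP[h|h]; [exists true|exists false]; move: h => /=;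
    by clear; lia.
have block p z : p \notin Z -> z \in Z -> ~~ is_knn k p z.
  move=> pZ zZ; rewrite is_knnE negb_and -leqNgt; apply/orP; right.
  have [d dout] := gapP p pZ.
  have [a [u [u0 [a1 a2] a3 aY aZ]]] := outer_coord s0 (ge0 p d) dout.
  have [r [v [v0 [r1 r2] rY rZ]]] := inner_coord (b (~~ d)) s0 (ge0 p (~~ d)).
  (* [B] consists of [7 * 13 = 91] ring cells near [p], which together hold more than [k] points. *)
  pose B : pred (nat * nat) := if d then box a r 7 13 else box r a 13 7.
  have BP c : B c = (a <= coord d c < a + 7)%N && (r <= coord (~~ d) c < r + 13)%N.
    by rewrite /B; case: (d) => //=; rewrite andbC.
  have kB : (k < #|in_cells s X B|)%N.
    apply: leq_trans kt _.
    have tB c : B c -> (t <= #|in_cells s X (pred1 c)|)%N.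
      rewrite BP => cB; apply: ring; move: cB a1 a2 a3 r1 r2; rewrite /box /b;
        by case: (d) => /=; clear; lia.
    by rewrite /B; move: tB; rewrite /B; case: (d) => tB; exact: in_cells_box_card tB.
  have Bclose : in_cells s X B :\ p \subset closer p z.
    apply/fintype.subsetP => y; rewrite !inE BP => /andP[-> /andP[yd yd']] /=.
    rewrite !(sqdist_rcoord d); apply: outer_closer s0 u0 v0 _ _ _ _.
    - by apply: (aY (rcoord d (val y)) (ge0 y d)); rewrite coord_cell in yd.
    - by apply: (rY (rcoord (~~ d) (val y)) (ge0 y (~~ d))); rewrite coord_cell in yd'.
    - exact: (aZ (rcoord d (val z)) (ge0 z d) (ZP z d zZ)).
    - case: rZ => [|rZ]; [by left|right].
      exact: (rZ (rcoord (~~ d) (val z)) (ge0 z (~~ d)) (ZP z (~~ d) zZ)).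
  apply: leq_trans (subset_leq_card Bclose).
  by move: kB; rewrite (cardsD1 p); case: (p \in _); clear; lia.
have self p z : p \notin Z -> z \in Z -> ~~ is_knn k z p.
  move=> pZ zZ; rewrite is_knnE negb_and -leqNgt; apply/orP; right.
  have close : Z :\ z \subset closer z p.
    apply/fintype.subsetP => y; rewrite finset.in_setD1 => /andP[yz yZ].
    rewrite [y \in closer z p]inE yz /=.
    have [d dout] := gapP p pZ.
    (* Coordinates within the center differ by less than 7 cell sides, whereas the moat alone
       separates [z] from [p] by 10. *)
    apply: (@lt_le_trans _ _ (98%:R * s ^+ 2)).
      have h d' : (rcoord d' (val z) - rcoord d' (val y)) ^+ 2 < (7 * s) ^+ 2.
        rewrite -sqr_norm_lt ?mulr_ge0 ?(ltW s0) //.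
        apply: (@trunc_div_dist _ _ _ _ 6) => //; have := ZP z d' zZ; have := ZP y d' yZ.
          by clear; lia.
        by clear; lia.
      rewrite (sqdist_rcoord true); have h1 := h true; have h2 := h false.
      rewrite (_ : 98%:R * s ^+ 2 = (7 * s) ^+ 2 + (7 * s) ^+ 2); last by ring.
      exact: ltrD h1 h2.
    apply: (@le_trans _ _ ((10%:R * s) ^+ 2)).
      by rewrite exprMn ler_wpM2r ?sqr_ge0 // -natrX ler_nat.
    rewrite (sqdist_rcoord d); apply: (@le_trans _ _ ((rcoord d (val z) - rcoord d (val p)) ^+ 2)).
      rewrite -sqr_norm_le ?mulr_ge0 ?(ltW s0) //.
      apply: le_trans (trunc_div_gap s0 (ge0 z d) (ge0 p d)).
      rewrite ler_pM2r // ler_nat.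
      move: (ZP z d zZ) dout; rewrite /gap.
      move: (Num.truncn _) (Num.truncn _) (b d) => m n b0; clear; lia.
    by rewrite lerDl sqr_ge0.
  apply: leq_trans (subset_leq_card close).
  by move: kZ; rewrite (cardsD1 z) zZ; clear; lia.
have [z zZ] : exists z, z \in Z.
  by apply/finset.set0Pn; rewrite -card_gt0; apply: leq_ltn_trans kZ.
have [p pZ] : exists p, p \notin Z.
  have c0 : box b1 b2 41 41 (b1, b2) by rewrite /box /=; clear; lia.
  have c1 : ~~ box (b1 + 7)%N (b2 + 7)%N 27 27 (b1, b2) by rewrite /box /=; clear; lia.
  have /leq_trans/(_ (ring _ c0 c1)) : (0 < t)%N by move: kt; clear; lia.
  rewrite card_gt0 => /finset.set0Pn[p]; rewrite inE => /eqP pc; exists p.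
  by rewrite inE pc /box /=; clear; lia.
have := conn finset.set0; rewrite cards0 => /(_ kappa0 z p); rewrite !inE.
move=> /(_ isT isT)/connect_boundary/(_ zZ pZ)[x [y [_ xZ yZ /and3P[_ _]]]].
by apply/negP; rewrite negb_or self // block.
Qed.

(** * Poisson estimates *)

Local Open Scope classical_set_scope.

(** Exponential change of measure: weighting by [expR (a * j)] turns the rate [mu] into
    [mu * expR a]. *)
Lemma poisson_pmf_tilt (R : realType) (mu a : R) (j : nat) : 0 < mu ->
  poisson_pmf mu j =
  expR (mu * (expR a - 1) - a * j%:R) * poisson_pmf (mu * expR a) j.
Proof.
move=> mu0; rewrite /poisson_pmf mu0 mulr_gt0 ?expR_gt0 // exprMn -expRM_natl.
rewrite [RHS](_ : _ = mu ^+ j / j`!%:R * (expR (mu * (expR a - 1) - a * j%:R) *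
  expR (j%:R * a) * expR (- (mu * expR a)))); last by ring.
by rewrite -!expRD; congr (_ * expR _); ring.
Qed.

(** After tilting, the remaining mass is at most 1. The sign of [a] selects the tail: upper if
    positive, lower if negative. *)
Lemma poisson_chernoff (R : realType) (mu a t : R) (U : set nat) : 0 <= mu ->
  (forall j, U j -> a * t <= a * j%:R) ->
  (poisson_prob mu 0 U <= (expR (mu * (expR a - 1) - a * t))%:E)%E.
Proof.
rewrite le_eqVlt => /predU1P[<-|mu0] Ut.
  rewrite /poisson_prob ltxx mul0r add0r diracE.
  have [|_] := boolP (0%N \in U); last by rewrite lee_fin expR_ge0.
  rewrite inE => /Ut; rewrite mulr0 => at0.
  by rewrite lee_fin -[leLHS]expR0 ler_expR oppr_ge0.
set c := expR _; have mu'0 : 0 < mu * expR a by rewrite mulr_gt0 ?expR_gt0.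
have c0 : 0 <= c by exact: expR_ge0.
rewrite [leLHS](_ : _ = (\sum_(j <oo | j \in U) (poisson_pmf mu j)%:E)%E); last first.
  rewrite nneseries_esum; last by move=> *; rewrite lee_fin poisson_pmf_ge0.
  by rewrite /poisson_prob mu0 set_mem_set.
apply: (@le_trans _ _ (\sum_(j <oo | j \in U) (c%:E * (poisson_pmf (mu * expR a) j)%:E))%E).
  apply: lee_nneseries => [j _ _|j]; first by rewrite lee_fin poisson_pmf_ge0.
  rewrite inE => Uj; rewrite -EFinM lee_fin (poisson_pmf_tilt a) //.
  rewrite ler_wpM2r ?poisson_pmf_ge0 // ler_expR lerD2l lerN2; exact: Ut.
rewrite nneseriesZl; last by move=> *; rewrite lee_fin poisson_pmf_ge0.
rewrite -[leRHS]mule1; apply: lee_pmul => //.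
- by rewrite nneseries_ge0 // => *; rewrite lee_fin poisson_pmf_ge0.
- have := probability_le1 (poisson_prob (mu * expR a) 0) (A := U) I.
  apply: le_trans.
  rewrite nneseries_esum; last by move=> *; rewrite lee_fin poisson_pmf_ge0.
  have E : poisson_prob (mu * expR a) 0 U =
      \esum_(i in U) (poisson_pmf (mu * expR a) i)%:E.
    by rewrite /poisson_prob mu'0.
  by rewrite set_mem_set -E.
Qed.

Lemma poisson_prob_ge (R : realType) (mu : R) (U : set nat) (t : nat) :
  0 < mu -> U t -> ((poisson_pmf mu t)%:E <= poisson_prob mu 0 U)%E.
Proof.
move=> mu0 Ut.
have -> : (poisson_pmf mu t)%:E = poisson_prob mu 0 [set t].
  by rewrite /poisson_prob mu0 esum_set1 // lee_fin poisson_pmf_ge0.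
by apply: le_measure; rewrite ?inE // => j ->.
Qed.

Lemma poisson_prob0 (R : realType) (mu : R) :
  0 < mu -> poisson_prob mu 0 [set 0%N] = (expR (- mu))%:E.
Proof.
move=> mu0; rewrite /poisson_prob mu0 esum_set1 /poisson_pmf mu0 fact0 invr1.
  by rewrite mulr1 mul1r.
by rewrite mulr1 mul1r lee_fin expR_ge0.
Qed.

(** * Cells as regions of the plane *)

Definition rect (R : realType) (s : R) (c : nat * nat) : set (R * R) :=
  `[c.1%:R * s, c.1.+1%:R * s[%classic `*` `[c.2%:R * s, c.2.+1%:R * s[%classic.

Definition cells (M : nat) (B : pred (nat * nat)) : seq (nat * nat) :=
  [seq c <- [seq (i, j) | i <- iota 0 M, j <- iota 0 M] | B c].

Definition region (R : realType) (s : R) (M : nat) (B : pred (nat * nat)) :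
    set (R * R) := \bigcup_(c in [set` cells M B]) rect s c.

Lemma mem_cells (M : nat) (B : pred (nat * nat)) (c : nat * nat) :
  (c \in cells M B) = [&& B c, c.1 < M & c.2 < M]%N.
Proof.
rewrite mem_filter; case: (B c) => //=; apply/allpairsP/andP.
  by move=> [[i j] /= [+ + ->]]; rewrite !mem_iota.
by move=> [c1 c2]; exists c; rewrite !mem_iota /= -surjective_pairing.
Qed.

Lemma uniq_cells (M : nat) (B : pred (nat * nat)) : uniq (cells M B).
Proof.
apply: filter_uniq; apply: allpairs_uniq; rewrite ?iota_uniq //.
by move=> [? ?] [? ?] _ _ [-> ->].
Qed.

Lemma rectP (R : realType) (s : R) (c : nat * nat) (p : R * R) : 0 < s ->
  rect s c p <-> [/\ 0 <= p.1, 0 <= p.2 & cell s p = c].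
Proof.
move=> s0; split.
  rewrite /rect /= !in_itv /= => -[/andP[a1 b1] /andP[a2 b2]].
  have p1 : 0 <= p.1 by apply: le_trans a1; rewrite mulr_ge0 ?ler0n ?ltW.
  have p2 : 0 <= p.2 by apply: le_trans a2; rewrite mulr_ge0 ?ler0n ?ltW.
  split=> //; case: c a1 b1 a2 b2 => i j /= a1 b1 a2 b2.
  rewrite /cell; congr (_, _); apply/eqP;
    by rewrite truncn_eq ?divr_ge0 ?(ltW s0) // ler_pdivlMr // ltr_pdivrMr // ?a1 ?a2.
move=> [p1 p2 <-]; rewrite /rect /= !in_itv /=.
by split; exact: trunc_divP.
Qed.

Lemma measurable_rect (R : realType) (s : R) (c : nat * nat) :
  measurable (rect s c).
Proof. by apply: measurableX; exact: measurable_itv. Qed.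

Lemma area_rect (R : realType) (s : R) (c : nat * nat) : 0 < s ->
  area (rect s c) = (s ^+ 2)%:E.
Proof.
move=> s0; rewrite /area product_measure1E; [|exact: measurable_itv..].
have E (i : nat) : lebesgue_measure (`[i%:R * s, i.+1%:R * s[%classic : set R) = s%:E.
  rewrite lebesgue_measure_itv /= lte_fin ltr_pM2r // ltr_nat ltnSn -EFinB.
  by rewrite -mulrBl -natr1 addrAC subrr add0r mul1r.
rewrite expr2 EFinM; congr (_ * _)%E; exact: E.
Qed.

Lemma measurable_region (R : realType) (s : R) (M : nat) (B : pred (nat * nat)) :
  measurable (region s M B).
Proof.
apply: fin_bigcup_measurable; first exact: finite_seq.
by move=> c _; exact: measurable_rect.
Qed.

Lemma trivIset_rect (R : realType) (s : R) (D : set (nat * nat)) :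
  0 < s -> trivIset D (rect s).
Proof.
move=> s0 c c' _ _ [p [/(rectP _ _ s0)[_ _ <-] /(rectP _ _ s0)[_ _ <-]]].
by [].
Qed.

Lemma area_region (R : realType) (s : R) (M : nat) (B : pred (nat * nat)) :
  0 < s -> area (region s M B) = ((size (cells M B))%:R * s ^+ 2)%:E.
Proof.
move=> s0; rewrite /area /region measure_fin_bigcup; last first.
- by move=> c _; exact: measurable_rect.
- exact: trivIset_rect.
- exact: finite_seq.
rewrite -fsbig_seq ?uniq_cells //.
rewrite (eq_bigr (fun=> (s ^+ 2)%:E)); last by move=> c _; exact: area_rect.
rewrite sumEFin; congr (_%:E).
by rewrite big_const_seq count_predT iter_addr_0 mulr_natl.
Qed.

Lemma regionP (R : realType) (s : R) (M : nat) (B : pred (nat * nat)) (p : R * R) :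
  0 < s -> region s M B p <->
  [/\ 0 <= p.1, 0 <= p.2, B (cell s p) & ((cell s p).1 < M)%N && ((cell s p).2 < M)%N].
Proof.
move=> s0; split.
  by move=> [c /= + /(rectP _ _ s0)[p1 p2 cE]]; rewrite mem_cells -cE => /and3P[-> -> ->].
move=> [p1 p2 Bc cM]; exists (cell s p); first by rewrite /= mem_cells Bc.
exact/rectP.
Qed.

Lemma region_square (R : realType) (s : R) (M : nat) (B : pred (nat * nat)) :
  0 < s -> region s M B `<=` square (M%:R * s).
Proof.
move=> s0 p /(regionP _ _ _ s0)[p1 p2 _ /andP[c1 c2]]; rewrite /square /=.
have /andP[_ b1] := trunc_divP s0 p1; have /andP[_ b2] := trunc_divP s0 p2.
rewrite !in_itv /= p1 p2 /=; split; apply: le_trans (ltW _) _; try eassumption.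
  by rewrite ler_pM2r // ler_nat.
by rewrite ler_pM2r // ler_nat.
Qed.

Lemma area_square (R : realType) (a : R) : 0 <= a -> area (square a) = (a ^+ 2)%:E.
Proof.
move=> a0; rewrite /area /square product_measure1E; [|exact: measurable_itv..].
suff E : lebesgue_measure (`[0, a]%classic : set R) = a%:E.
  by rewrite expr2 EFinM; congr (_ * _)%E; exact: E.
rewrite lebesgue_measure_itv /= lte_fin; case: ltP => [_|a0']; first by rewrite oppr0 adde0.
by congr (_%:E); apply/eqP; rewrite eq_le a0 a0'.
Qed.

Lemma size_cellsT (M : nat) : size (cells M predT) = (M * M)%N.
Proof. by rewrite /cells filter_predT size_allpairs !size_iota. Qed.

Lemma area_square_region (R : realType) (s : R) (M : nat) : 0 < s ->
  area (~` region s M predT `&` square (M%:R * s)) = 0%E.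
Proof.
move=> s0; have M0 : 0 <= M%:R * s :> R by rewrite mulr_ge0 ?ler0n ?ltW.
have mS : measurable (square (M%:R * s)) by apply: measurableX; exact: measurable_itv.
rewrite setIC -setDE.
apply: etrans (measureD (mu := (@lebesgue_measure R \x @lebesgue_measure R)%E)
  mS (measurable_region s M predT) _) _.
  by apply: le_lt_trans (ltry (M%:R * s * (M%:R * s))); rewrite -expr2 -area_square.
rewrite setIidr; last exact: region_square.
apply: etrans (congr2 (fun a b => a - b)%E (area_square M0) (area_region M predT s0)) _.
by rewrite size_cellsT -EFinB natrM exprMn expr2 subrr.
Qed.

Lemma poisson_process_region (R : realType) (d : measure_display)
    (T : measurableType d) (P : probability T R) (X : T -> {fset R * R})
    (s : R) (M : nat) (B : pred (nat * nat)) (U : set nat) :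
  0 < s -> poisson_process P (square (M%:R * s)) X ->
  P (npoints X (region s M B) @^-1` U) =
  poisson_prob ((size (cells M B))%:R * s ^+ 2) 0 U.
Proof.
move=> s0 [_ _ PX _]; rewrite PX; last exact: measurable_region.
by rewrite setIidl ?area_region //; exact: region_square.
Qed.

Lemma measurable_npoints (R : realType) (d : measure_display)
    (T : measurableType d) (P : probability T R) (D : set (R * R))
    (X : T -> {fset R * R}) (B : set (R * R)) (U : set nat) :
  poisson_process P D X -> measurable B -> measurable (npoints X B @^-1` U).
Proof.
by move=> [_ mX _ _] /mX mB; rewrite -[_ @^-1` _]setTI; exact: mB.
Qed.

(** Cells are half-open but the square is closed: this event, of probability 1, excludes points on
    its two far sides. *)
Definition grid_event (R : realType) (T : Type) (X : T -> {fset R * R}) (s : R)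
    (M : nat) : set T := npoints X (~` region s M predT) @^-1` [set 0%N].

Lemma grid_event_in_grid (R : realType) (T : Type) (X : T -> {fset R * R}) (s : R)
    (M : nat) (w : T) :
  0 < s -> grid_event X s M w -> in_grid s M (X w).
Proof.
move=> s0 gw p pX.
have : p \notin [fset p in X w | p \in ~` region s M predT]%fset.
  by have /eqP := gw; rewrite cardfs_eq0 => /eqP ->; rewrite inE.
rewrite !inE pX notin_setE /= => /contrapT/(regionP _ _ _ s0)[p1 p2 _ /andP[c1 c2]].
have /andP[_ b1] := trunc_divP s0 p1; have /andP[_ b2] := trunc_divP s0 p2.
rewrite p1 p2 /=; apply/andP; split.
  by apply: lt_le_trans b1 _; rewrite ler_pM2r // ler_nat.
by apply: lt_le_trans b2 _; rewrite ler_pM2r // ler_nat.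
Qed.

Lemma npoints_in_cells (R : realType) (T : Type) (X : T -> {fset R * R}) (s : R)
    (M : nat) (B : pred (nat * nat)) (w : T) :
  0 < s -> in_grid s M (X w) ->
  npoints X (region s M B) w = #|in_cells s (X w) B|.
Proof.
move=> s0 gX; rewrite /npoints -(@card_fsub _ (X w)); last first.
  by apply/fsubsetP => p; rewrite !inE => /andP[].
apply: eq_card => x; rewrite !inE (valP x) /=; apply/idP/idP.
  by rewrite inE => /(regionP _ _ _ s0)[].
move=> Bx; rewrite inE; apply/(regionP _ _ _ s0).
have /and4P[x1 x2 _ _] := gX _ (valP x); split=> //.
have := in_grid_cell x true s0 gX; have := in_grid_cell x false s0 gX.
by move=> /= -> ->.
Qed.

Lemma measurable_grid_event (R : realType) (d : measure_display)
    (T : measurableType d) (P : probability T R) (D : set (R * R))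
    (X : T -> {fset R * R}) (s : R) (M : nat) :
  poisson_process P D X -> measurable (grid_event X s M).
Proof.
move=> /measurable_npoints; apply; apply: measurableC; exact: measurable_region.
Qed.

Lemma prob_grid_event (R : realType) (d : measure_display)
    (T : measurableType d) (P : probability T R) (X : T -> {fset R * R})
    (s : R) (M : nat) :
  0 < s -> poisson_process P (square (M%:R * s)) X ->
  P (~` grid_event X s M) = 0%E.
Proof.
move=> s0 PX; have [_ _ PX' _] := PX.
rewrite /grid_event preimage_setC PX'; last by apply: measurableC; exact: measurable_region.
rewrite area_square_region // /poisson_prob ltxx diracE.
by rewrite memNset //= => /(_ erefl).
Qed.

Lemma union_bound (R : realType) (d : measure_display) (T : measurableType d)
    (P : probability T R) (I : finType) (E : I -> set T) (b : R) :
  (forall i, measurable (E i)) -> (forall i, (P (E i) <= b%:E)%E) ->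
  measurable (\bigcup_(i in [set: I]) E i) /\
  (P (\bigcup_(i in [set: I]) E i) <= (#|I|%:R * b)%:E)%E.
Proof.
move=> mE Eb.
have -> : \bigcup_(i in [set: I]) E i = \big[setU/set0]_(i <- enum I) E i.
  rewrite -bigcup_seq; congr (\bigcup_(i in _) _); apply/seteqP.
  by split=> i //= _; rewrite mem_enum.
rewrite cardE; elim: (enum I) => [|i r [mr IHr]].
  by rewrite big_nil measure0 mul0r; split=> //; exact: measurable0.
rewrite big_cons; split; first exact: measurableU.
apply: (le_trans (measureU2 P (mE i) mr)).
by rewrite /= -natr1 mulrDl mul1r addrC EFinD leeD.
Qed.

Lemma prode_le (R : realType) (m : nat) (x : 'I_m -> \bar R) (b : R) :
  (forall i, 0 <= x i)%E -> (forall i, x i <= b%:E)%E ->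
  (\prod_(i < m) x i <= (b ^+ m)%:E)%E.
Proof.
elim: m x => [|m IHm] x x0 xb; first by rewrite big_ord0 expr0.
rewrite big_ord_recr /= exprSr EFinM; apply: lee_pmul => //.
  by apply: prode_ge0.
exact: IHm.
Qed.

Lemma size_cells_box (M i j a b : nat) : (size (cells M (box i j a b)) <= a * b)%N.
Proof.
have -> : (a * b)%N = size [seq (u, v) | u <- iota i a, v <- iota j b].
  by rewrite size_allpairs !size_iota.
apply: uniq_leq_size; first exact: uniq_cells.
move=> [u v]; rewrite mem_cells /box /= => /and3P[/andP[ui vj] _ _].
by apply/allpairsP; exists (u, v); rewrite /= !mem_iota ui vj.
Qed.

Lemma size_cells_box_in (M i j a b : nat) : (i + a <= M)%N -> (j + b <= M)%N ->
  size (cells M (box i j a b)) = (a * b)%N.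
Proof.
move=> iM jM; apply/eqP; rewrite eqn_leq size_cells_box /=.
have -> : (a * b)%N = size [seq (u, v) | u <- iota i a, v <- iota j b].
  by rewrite size_allpairs !size_iota.
apply: uniq_leq_size.
  by apply: allpairs_uniq; rewrite ?iota_uniq // => -[? ?] [? ?] _ _ [-> ->].
move=> _ /allpairsP[[u v] /= [+ + ->]]; rewrite !mem_iota mem_cells /box /=.
by move: iM jM; clear; lia.
Qed.

Lemma size_cells1 (M : nat) (c : nat * nat) : (c.1 < M)%N -> (c.2 < M)%N ->
  size (cells M (pred1 c)) = 1%N.
Proof.
case: c => a b aM bM; rewrite -[1%N]/(size [:: (a, b)]).
apply/eqP; rewrite -uniq_size_uniq ?uniq_cells // => -[u v].
rewrite mem_cells mem_seq1 /=; case: eqP => // -[-> ->].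
by rewrite aM bM.
Qed.

(** The ball is a square of 7 by 7 cells without three cells at each corner; it is counted by
    computation after moving its center to [(3, 3)]. *)
Lemma size_cells_ball (M : nat) (c : nat * nat) :
  (size (cells M (cell_ball c)) <= 37)%N.
Proof.
pose off (c' : nat * nat) := ((c'.1 + 3 - c.1)%N, (c'.2 + 3 - c.2)%N).
pose o := [seq c' <- [seq (i, j) | i <- iota 0 7, j <- iota 0 7] | cell_ball (3, 3)%N c'].
have -> : 37%N = size o by [].
have near c' : cell_ball c c' -> [/\ (c.1 <= c'.1 + 3)%N, (c'.1 <= c.1 + 3)%N,
    (c.2 <= c'.2 + 3)%N & (c'.2 <= c.2 + 3)%N].
  have G i j : (gap i j ^ 2 < 5)%N -> (i <= j + 3)%N /\ (j <= i + 3)%N.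
    move=> g; have : (gap i j < 3)%N.
      rewrite ltnNge; apply: contraL g.
       by rewrite -leqNgt -(leq_exp2r 3 _ (isT : 0 < 2)%N); apply: leq_trans.
    by rewrite /gap; clear; lia.
  rewrite /cell_ball /= => g.
  have [] := G c.1 c'.1 (leq_ltn_trans (leq_addr _ _) g).
  by have [] := G c.2 c'.2 (leq_ltn_trans (leq_addl _ _) g).
rewrite -(size_map off); apply: uniq_leq_size.
  rewrite map_inj_in_uniq ?uniq_cells // => -[a b] [a' b'].
  rewrite !mem_cells => /andP[/near/= + _] /andP[/near/= + _].
  move=> [h1 h2 h3 h4] [h1' h2' h3' h4'] [e1 e2]; congr (_, _);
    by move: h1 h2 h3 h4 h1' h2' h3' h4' e1 e2; clear; lia.
move=> _ /mapP[c' + ->]; rewrite mem_cells => /andP[/[dup] g /near[h1 h2 h3 h4] _].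
rewrite mem_filter; apply/andP; split.
  move: g; rewrite /cell_ball /=; congr (_ ^ 2 + _ ^ 2 < 5)%N; rewrite /gap;
    by move: h1 h2 h3 h4; clear; lia.
by apply/allpairsP; exists (off c'); split=> //; rewrite mem_iota /off;
  move: h1 h2 h3 h4; clear=> /=; lia.
Qed.

(** * Numerical Chernoff exponents *)

Lemma expR_ge_pow (R : realType) (x : R) (m : nat) :
  0 <= 1 + x -> (1 + x) ^+ m <= expR (m%:R * x).
Proof.
by move=> x1; rewrite expRM_natl lerXn2r ?nnegrE ?expR_ge0 ?expR_ge1Dx.
Qed.

Lemma expR_le_pow (R : realType) (x : R) (m : nat) :
  0 < 1 - x -> expR (m%:R * x) <= (1 - x) ^- m.
Proof.
move=> x1; rewrite -[x]opprK mulrN expRN opprK lef_pV2 ?posrE ?exprn_gt0 ?expR_gt0 //.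
by apply: expR_ge_pow; exact: ltW.
Qed.

(** The tilt [-8] nearly yields the probability of an empty cell, as
    [159 / 160 * 10 / 473 > 21 / 1000], at the price of a factor independent of [k]. *)
Lemma low_cell_exponent (R : realType) (kappa : nat) (mu k : R) :
  0 <= k -> k <= 473 / 10 * mu ->
  mu * (expR (-8) - 1) - -8 * kappa%:R <= 8 * kappa%:R - 21 / 1000 * k.
Proof.
move=> k0 kmu; have e8 : expR (-8) <= 1 / 160 :> R.
  rewrite expRN div1r lef_pV2 ?posrE ?expR_gt0 //.
  have := @expR_ge_pow R 1 8 (addr_ge0 ler01 ler01); rewrite mulr1.
  by apply: le_trans; lra.
have : 0 <= mu * (1 / 160 - expR (-8)) by apply: mulr_ge0; lra.
by lra.
Qed.

(** The tilt is close to the optimum [ln (47 / 37)], and [37 / 47 * (53 / 200) - 23 / 100 < - 21 /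
    1000]. *)
Lemma dense_ball_exponent (R : realType) (mu k : R) :
  0 <= k -> 0 <= mu -> 47 * mu <= 37 * k ->
  mu * (expR (23 / 100) - 1) - 23 / 100 * k <= - (21 / 1000 * k).
Proof.
move=> k0 mu0 muk; have e23 : expR (23 / 100) <= 253 / 200 :> R.
  have : 0 < 1 - 23 / 800 :> R by lra.
  move=> /(@expR_le_pow R _ 8).
  rewrite (_ : 8 * (23 / 800) = 23 / 100 :> R); last by field.
  move=> /le_trans; apply.
  rewrite -[leRHS]invrK invf_div lef_pV2 ?posrE; [lra| |lra].
  by apply: exprn_gt0; lra.
have : 0 <= mu * (253 / 200 - expR (23 / 100)) by apply: mulr_ge0; lra.
by lra.
Qed.

(** A block of 576 cells has mean above [12 * k]; already the tilt [-2] gives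
    [5760 / 473 * (5 / 6) - 2 > 81 / 10]. *)
Lemma long_edge_exponent (R : realType) (mu k : R) :
  0 <= k -> 576 * k <= 473 / 10 * mu ->
  mu * (expR (-2) - 1) - -2 * k <= - (81 / 10 * k).
Proof.
move=> k0 kmu; have e2 : expR (-2) <= 1 / 6 :> R.
  rewrite expRN div1r lef_pV2 ?posrE ?expR_gt0 //.
  have : 0 <= 1 + 1 / 5 :> R by lra.
  move=> /(@expR_ge_pow R _ 10).
  rewrite (_ : 10 * (1 / 5) = 2 :> R); last by field.
  by apply: le_trans; lra.
have : 0 <= mu * (1 / 6 - expR (-2)) by apply: mulr_ge0; lra.
by lra.
Qed.

(** The mean is at most [K ^+ 2 * k / 47] and the threshold [t] at least [kappa * k / 8]. The last
    hypothesis is the constraint that determines [kappa]. *)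
Lemma window_exponent (R : realType) (mu k t K kappa : R) :
  1 <= k -> 0 <= mu -> 47 * mu <= K ^+ 2 * k -> kappa * k <= 8 * t ->
  K ^+ 2 / 9 / 47 + 81 / 10 <= kappa / 80 ->
  mu * (expR (1 / 10) - 1) - 1 / 10 * t <= - (81 / 10 * k).
Proof.
move=> k1 mu0 muk kt Kk; have e1 : expR (1 / 10) <= 10 / 9 :> R.
  rewrite -[X in expR X]opprK expRN -[leRHS]invrK invf_div.
  rewrite lef_pV2 ?posrE ?expR_gt0 ?divr_gt0 //.
  by apply: le_trans (expR_ge1Dx _); lra.
have h1 : 0 <= mu * (10 / 9 - expR (1 / 10)) by apply: mulr_ge0; lra.
have h2 : 0 <= (kappa / 80 - (K ^+ 2 / 9 / 47 + 81 / 10)) * k.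
  by apply: mulr_ge0; lra.
by lra.
Qed.

(** * Dense regime *)

Definition window_event (R : realType) (T : Type) (X : T -> {fset R * R}) (s : R)
    (M K n : nat) (c : 'I_M * 'I_M) : set T :=
  npoints X (region s M (box c.1 c.2 K K)) @^-1` [set m | (n < 8 * m)%N].

Definition long_event (R : realType) (T : Type) (X : T -> {fset R * R}) (s : R)
    (M k : nat) (c : 'I_M * 'I_M) : set T :=
  if (c.1 + 24 <= M)%N && (c.2 + 24 <= M)%N then
    npoints X (region s M (box c.1 c.2 24 24)) @^-1` [set m | (m <= k)%N]
  else set0.

Lemma prob_window_event (R : realType) (d : measure_display)
    (T : measurableType d) (P : probability T R) (X : T -> {fset R * R})
    (s : R) (M K k kappa : nat) (c : 'I_M * 'I_M) :
  0 < s -> poisson_process P (square (M%:R * s)) X -> (0 < k)%N ->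
  47 * s ^+ 2 <= k%:R ->
  K%:R ^+ 2 / 9 / 47 + 81 / 10 <= kappa%:R / 80 :> R ->
  (P (window_event X s K (kappa * k) c) <= (expR (- (81 / 10 * k%:R)))%:E)%E.
Proof.
move=> s0 PX k0 sk Kkappa; rewrite (poisson_process_region _ _ s0 PX).
have mu0 : 0 <= (size (cells M (box c.1 c.2 K K)))%:R * s ^+ 2.
  by rewrite mulr_ge0 ?ler0n ?sqr_ge0.
apply: le_trans (poisson_chernoff (a := 1 / 10) (t := (kappa * k)%:R / 8) mu0 _) _.
  move=> j /= /ltnW; rewrite -(ler_nat R) [X in _ <= X]natrM => kj.
  rewrite ler_pM2l ?divr_gt0 // ler_pdivrMr // [_ * 8]mulrC; exact: kj.
rewrite lee_fin ler_expR; apply: window_exponent Kkappa => //.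
- by rewrite ler1n.
- rewrite mulrCA; apply: ler_pM sk; first exact: ler0n.
    by rewrite mulr_ge0 ?sqr_ge0.
  by rewrite -natrX ler_nat expnS expn1 size_cells_box.
- by rewrite [8 * _]mulrC divfK ?natrM // pnatr_eq0.
Qed.

Lemma prob_long_event (R : realType) (d : measure_display)
    (T : measurableType d) (P : probability T R) (X : T -> {fset R * R})
    (s : R) (M k : nat) (c : 'I_M * 'I_M) :
  0 < s -> poisson_process P (square (M%:R * s)) X ->
  k%:R <= 473 / 10 * s ^+ 2 ->
  (P (long_event X s k c) <= (expR (- (81 / 10 * k%:R)))%:E)%E.
Proof.
move=> s0 PX sk; rewrite /long_event; case: ifP => [/andP[c1 c2]|_]; last first.
  by rewrite measure0 lee_fin expR_ge0.
rewrite (poisson_process_region _ _ s0 PX) size_cells_box_in //.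
have mu0 : 0 <= (24 * 24)%:R * s ^+ 2 by rewrite mulr_ge0 ?ler0n ?sqr_ge0.
apply: le_trans (poisson_chernoff (a := -2) (t := k%:R) mu0 _) _.
  by move=> j /= jk; rewrite ler_nM2l ?ler_nat // oppr_lt0.
rewrite lee_fin ler_expR; apply: long_edge_exponent => //.
by have -> : (24 * 24)%:R = 576 :> R by []; lra.
Qed.

(** The boolean records why [c] is not good: too few points in the cell ([true]) or too many in its
    ball ([false]). *)
Definition bad_region (c : nat * nat) (b : bool) : pred (nat * nat) :=
  fun c' => if b then c' == c else cell_ball c c'.

Definition bad_count (kappa k : nat) (b : bool) : set nat :=
  if b then [set m | (m < kappa)%N] else [set m | (k < m)%N].

Lemma prob_bad_cell (R : realType) (d : measure_display)
    (T : measurableType d) (P : probability T R) (X : T -> {fset R * R})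
    (s : R) (M kappa k : nat) (c : nat * nat) (b : bool) :
  0 < s -> poisson_process P (square (M%:R * s)) X ->
  (forall d', (coord d' c < M)%N) ->
  47 * s ^+ 2 <= k%:R -> k%:R <= 473 / 10 * s ^+ 2 ->
  (P (npoints X (region s M (bad_region c b)) @^-1` bad_count kappa k b) <=
   (expR (8 * kappa%:R - 21 / 1000 * k%:R))%:E)%E.
Proof.
move=> s0 PX cM sk ks; rewrite (poisson_process_region _ _ s0 PX).
case: b => /=.
  rewrite size_cells1 ?mul1r; [|exact: (cM true)|exact: (cM false)].
  apply: le_trans (poisson_chernoff (a := -8) (t := kappa%:R) (sqr_ge0 s) _) _.
    by move=> j /= jk; rewrite ler_nM2l ?ler_nat ?oppr_lt0 // ltnW.
  by rewrite lee_fin ler_expR; apply: low_cell_exponent.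
have mu0 : 0 <= (size (cells M (cell_ball c)))%:R * s ^+ 2.
  by rewrite mulr_ge0 ?ler0n ?sqr_ge0.
apply: le_trans (poisson_chernoff (a := 23 / 100) (t := k%:R) mu0 _) _.
  by move=> j /= /ltnW kj; rewrite ler_pM2l ?divr_gt0 // ler_nat.
rewrite lee_fin ler_expR; apply: (le_trans (dense_ball_exponent _ mu0 _)).
- exact: ler0n.
- rewrite mulrCA; apply: ler_pM sk; first exact: ler0n.
    by rewrite mulr_ge0 ?sqr_ge0.
  by rewrite ler_nat size_cells_ball.
- by have := ler0n R kappa; lra.
Qed.

Definition offset_cell (J : nat) (i0 : bool -> nat)
    (o : 'I_(40 * (2 * J + 1)) * 'I_(40 * (2 * J + 1))) : nat * nat :=
  (40 * (i0 true - J) + o.1, 40 * (i0 false - J) + o.2)%N.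

(** Cells are given by offsets from the surroundings of a position, so there are only [I ^ 2] times
    a constant many indices. Those that do not describe cells of distinct strips receive the empty
    event below. *)
Definition strip_index (I J : nat) : finType :=
  (bool * ('I_I * 'I_I) *
   {ffun 'I_J -> 'I_(40 * (2 * J + 1)) * 'I_(40 * (2 * J + 1)) * bool})%type.

Definition strip_event (R : realType) (T : Type) (X : T -> {fset R * R}) (s : R)
    (I J kappa k : nat) (x : strip_index I J) : set T :=
  let: (d, i, g) := x in
  let i0 := fun d' : bool => if d' then i.1 : nat else i.2 : nat in
  let c := fun j => offset_cell i0 (g j).1 in
  if `[< (forall j, (forall d', (coord d' (c j) < 40 * I)%N) /\
           (3 <= coord d (c j) %% 40 < 37)%N) /\
         injective (fun j => (coord d (c j) %/ 40)%N) >] then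
    \bigcap_(j in [set: 'I_J]) (npoints X (region s (40 * I)%N (bad_region (c j) (g j).2))
       @^-1` bad_count kappa k (g j).2)
  else set0.

Lemma bad_region_strip (d : bool) (c c' : nat * nat) (b : bool) :
  (3 <= coord d c %% 40 < 37)%N -> bad_region c b c' ->
  (coord d c' %/ 40 = coord d c %/ 40)%N.
Proof.
case: b => /=; first by rewrite /bad_region => _ /eqP ->.
move=> cm; have G i j : (gap i j ^ 2 < 5)%N -> (i <= j + 3)%N /\ (j <= i + 3)%N.
  move=> g; have : (gap i j < 3)%N.
    by rewrite ltnNge; apply: contraL g; rewrite -leqNgt -(leq_exp2r 3 _ (isT : 0 < 2)%N);
      apply: leq_trans.
  by rewrite /gap; clear; lia.
rewrite /bad_region /cell_ball /= => g.
have : (coord d c <= coord d c' + 3)%N /\ (coord d c' <= coord d c + 3)%N.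
  by case: (d); apply: G; apply: leq_ltn_trans g; rewrite ?leq_addr ?leq_addl.
by move: cm; clear; lia.
Qed.

(** Balls of trimmed cells stay in their strips, so the [J] regions are disjoint and the bounds for
    single bad cells multiply. *)
Lemma prob_strip_event (R : realType) (d : measure_display)
    (T : measurableType d) (P : probability T R) (X : T -> {fset R * R})
    (s : R) (I J kappa k : nat) (x : strip_index I J) :
  0 < s -> poisson_process P (square ((40 * I)%:R * s)) X ->
  47 * s ^+ 2 <= k%:R -> k%:R <= 473 / 10 * s ^+ 2 ->
  81 / 10 <= 21 / 1000 * J%:R :> R ->
  measurable (strip_event X s kappa k x) /\
  (P (strip_event X s kappa k x) <=
   (expR (8 * kappa%:R) ^+ J * expR (- (81 / 10 * k%:R)))%:E)%E.
Proof.
move=> s0 PX sk ks J0; case: x => -[dir i] g; rewrite /strip_event.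
case: asboolP => [[cM cinj]|_]; last first.
  split; first exact: measurable0.
  by rewrite measure0 lee_fin mulr_ge0 ?exprn_ge0 ?expR_ge0.
set i0 := (fun d' : bool => _) in cM cinj *.
pose c j := offset_cell i0 (g j).1.
have {}cM : forall j, (forall d', (coord d' (c j) < 40 * I)%N) /\
  (3 <= coord dir (c j) %% 40 < 37)%N := cM.
have {}cinj : injective (fun j => (coord dir (c j) %/ 40)%N) := cinj.
split.
  apply: fin_bigcap_measurable; first exact: finite_finset.
  by move=> j _; exact: measurable_npoints PX (measurable_region _ _ _).
have [_ _ _ /(_ J (fun j => region s (40 * I)%N (bad_region (c j) (g j).2)))] := PX.
move=> /(_ (fun j => measurable_region _ _ _)) indep.
rewrite indep; last first.
  move=> j j' _ _ [p [/(regionP _ _ _ s0)[_ _ p1 _] /(regionP _ _ _ s0)[_ _ p2 _]]].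
  apply: cinj => /=; rewrite -(bad_region_strip (proj2 (cM j)) p1).
  by rewrite (bad_region_strip (proj2 (cM j')) p2).
apply: le_trans (prode_le _ _) _.
- by move=> j; exact: measure_ge0.
- move=> j; apply: prob_bad_cell s0 PX _ sk ks.
  by have [] := cM j.
rewrite lee_fin -!expRM_natl -expRD ler_expR.
have := ler0n R k; move: J0; set x := J%:R => J0 k0.
have : 0 <= (21 / 1000 * x - 81 / 10) * k%:R by apply: mulr_ge0; lra.
by lra.
Qed.

Definition grid_ok (R : realType) (kappa k J I K : nat) (s : R)
    (X : {fset R * R}) : Prop :=
  [/\ in_grid s (40 * I)%N X,
      forall i j, (i < 40 * I)%N -> (j < 40 * I)%N ->
        (8 * #|in_cells s X (box i j K K)| <= kappa * k)%N &
      (J < I)%N ->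
        (forall i j, (i + 24 <= 40 * I)%N -> (j + 24 <= 40 * I)%N ->
          (k < #|in_cells s X (box i j 24 24)|)%N) /\
        few_bad_strips kappa k J (40 * I)%N s X].

Lemma few_bad_strips_event (R : realType) (T : Type) (X : T -> {fset R * R})
    (s : R) (I J kappa k : nat) (w : T) :
  0 < s -> in_grid s (40 * I)%N (X w) ->
  (forall x : strip_index I J, ~ strip_event X s kappa k x w) ->
  few_bad_strips kappa k J (40 * I)%N s (X w).
Proof.
move=> s0 gX noev dir i0 c i0M cP cinj; apply: contrapT => nogood.
have i0I d' : (i0 d' < I)%N by have := i0M d'; clear; lia.
have off d' j : (coord d' (c j) - 40 * (i0 d' - J) < 40 * (2 * J + 1))%N.
  by have [/(_ d')[_ +] _] := cP j; clear; lia.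
pose g : {ffun 'I_J -> 'I_(40 * (2 * J + 1)) * 'I_(40 * (2 * J + 1)) * bool} :=
  [ffun j => (Ordinal (off true j), Ordinal (off false j),
    (#|in_cells s (X w) (pred1 (c j))| < kappa)%N)].
pose i : 'I_I * 'I_I := (Ordinal (i0I true), Ordinal (i0I false)).
apply: (noev (dir, i, g)); rewrite /strip_event.
have cE j : offset_cell (fun d' : bool => if d' then i.1 : nat else i.2 : nat)
    (g j).1 = c j.
  rewrite /offset_cell ffunE /=.
  have [/(_ true)[_ h1] _] := cP j; have [/(_ false)[_ h2] _] := cP j.
  by case: (c j) h1 h2 => a b /= h1 h2; congr (_, _); move: h1 h2; clear; lia.
case: asboolP => [_|]; last first.
  case; split; last by move=> j j'; rewrite !cE; exact: cinj.
  by move=> j; rewrite cE; have [h1 h2] := cP j; split=> // d'; have [] := h1 d'.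
move=> j _ /=; rewrite cE npoints_in_cells // ffunE /=.
case: (boolP (#|in_cells s (X w) (pred1 (c j))| < kappa)%N) => [low|].
  apply: leq_ltn_trans low; apply: subset_leq_card.
  by apply/fintype.subsetP => x; rewrite !inE.
rewrite -leqNgt => low; rewrite /bad_count /= ltnNge; apply/negP => ball.
by apply: nogood; exists j; rewrite /good_cell low.
Qed.

(** [C] absorbs the number of offset configurations and the factors [expR (8 * kappa)]; it is fixed
    before the process and [k], which makes the bound uniform in [n]. *)
Lemma grid_ok_prob (R : realType) (kappa J : nat) :
  let K := (40 * (J + 2) + 136)%N in
  81 / 10 <= 21 / 1000 * J%:R :> R ->
  K%:R ^+ 2 / 9 / 47 + 81 / 10 <= kappa%:R / 80 :> R ->
  exists2 C : R, 0 <= C & forall (d : measure_display) (T : measurableType d)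
    (P : probability T R) (X : T -> {fset R * R}) (s : R) (I k : nat),
    0 < s -> poisson_process P (square ((40 * I)%:R * s)) X -> (0 < k)%N ->
    47 * s ^+ 2 <= k%:R -> ((J < I)%N -> k%:R <= 473 / 10 * s ^+ 2) ->
    exists E : set T, [/\ measurable E,
      (P E <= (C * (40 * I)%:R ^+ 2 * expR (- (81 / 10 * k%:R)))%:E)%E &
      forall w, ~ E w -> grid_ok kappa k J I K s (X w)].
Proof.
move=> K hJ hK.
pose F := #|{ffun 'I_J -> 'I_(40 * (2 * J + 1)) * 'I_(40 * (2 * J + 1)) * bool}|.
have F0 : 0 <= 2 * F%:R * expR (8 * kappa%:R) ^+ J :> R.
  by rewrite !mulr_ge0 ?ler0n ?exprn_ge0 ?expR_ge0.
exists (2 + 2 * F%:R * expR (8 * kappa%:R) ^+ J); first exact: addr_ge0.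
move=> d T P X s I k s0 PX k0 sk ks.
set M := (40 * I)%N; set q := expR (- (81 / 10 * k%:R)).
have q0 : 0 <= q by exact: expR_ge0.
have mWc (c : 'I_M * 'I_M) : measurable (window_event X s K (kappa * k) c).
  exact: measurable_npoints PX (measurable_region _ _ _).
have [mW PW] := union_bound mWc
  (fun c : 'I_M * 'I_M => prob_window_event c s0 PX k0 sk hK).
set W := \bigcup_(i in _) _ in mW PW.
pose L := \bigcup_(c in [set: 'I_M * 'I_M]) long_event X s k c.
pose S := \bigcup_(x in [set: strip_index I J]) strip_event X s kappa k x.
pose LS := if (J < I)%N then L `|` S else set0.
have mG : measurable (~` grid_event X s M).
  by apply: measurableC; exact: measurable_grid_event PX.
have M2 : #|{: 'I_M * 'I_M}|%:R = M%:R ^+ 2 :> R.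
  by rewrite card_prod card_ord natrM expr2.
have [mLS PLS] : measurable LS /\
    (P LS <= ((1 + 2 * F%:R * expR (8 * kappa%:R) ^+ J) * M%:R ^+ 2 * q)%:E)%E.
  rewrite /LS; case: ifP => [JI|_]; last first.
    split; first exact: measurable0.
    by rewrite measure0 lee_fin !mulr_ge0 ?addr_ge0 // exprn_ge0 ?ler0n.
  have {}ks := ks JI.
  have mLc (c : 'I_M * 'I_M) : measurable (long_event X s k c).
    rewrite /long_event; case: ifP => _; last exact: measurable0.
    exact: measurable_npoints PX (measurable_region _ _ _).
  have [mL PL] := union_bound mLc (fun c => prob_long_event c s0 PX ks).
  have [mS PS] := union_bound
    (fun x : strip_index I J => (prob_strip_event kappa x s0 PX sk ks hJ).1)
    (fun x => (prob_strip_event kappa x s0 PX sk ks hJ).2).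
  split; first exact: measurableU.
  apply: (le_trans (measureU2 P mL mS)); apply: (le_trans (leeD PL PS)).
  rewrite -EFinD lee_fin M2 -/q; set e := expR (8 * kappa%:R) ^+ J.
  have e0 : 0 <= e by rewrite exprn_ge0 ?expR_ge0.
  rewrite [leRHS](_ : _ = M%:R ^+ 2 * q + 2 * M%:R ^+ 2 * F%:R * (e * q)); last by ring.
  rewrite lerD2l; apply: ler_wpM2r; first exact: mulr_ge0.
  rewrite !card_prod card_bool !card_ord -/F !natrM ler_wpM2r ?ler0n //.
  rewrite ler_pM2l // expr2; apply: ler_pM; rewrite ?ler0n //;
    by rewrite -natrM ler_nat; clear; lia.
exists (~` grid_event X s M `|` (W `|` LS)); split.
- by apply: measurableU => //; exact: measurableU.
- apply: (le_trans (measureU2 P mG (measurableU _ _ mW mLS))).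
  have PG : (P (~` grid_event X s M) <= 0)%E by rewrite (prob_grid_event s0 PX).
  have PWLS := le_trans (measureU2 P mW mLS) (leeD PW PLS).
  apply: (le_trans (leeD PG PWLS)).
  by rewrite add0e -EFinD lee_fin M2 -/q; lra.
move=> w /not_orP[/contrapT gw /not_orP[nW nLS]].
have gX := grid_event_in_grid s0 gw.
split=> // [i j iM jM|JI].
  rewrite leqNgt; apply/negP => Kij; apply: nW.
  exists (Ordinal iM, Ordinal jM) => //; rewrite /window_event /=.
  by rewrite npoints_in_cells.
move: nLS; rewrite /LS JI => /not_orP[nL nS]; split.
  move=> i j iM jM; rewrite ltnNge; apply/negP => kij; apply: nL.
  have iM' : (i < M)%N by move: iM; rewrite -/M; clear; lia.
  have jM' : (j < M)%N by move: jM; rewrite -/M; clear; lia.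
  exists (Ordinal iM', Ordinal jM') => //; rewrite /long_event /= iM jM /=.
  by rewrite npoints_in_cells.
apply: few_bad_strips_event => // x xw; apply: nS.
by exists x.
Qed.

(** The window side is [15816], and the inequality reads about [591370 <= 625000]: this is what the
    value of [kappa] is for. *)
Lemma window_constant (R : realType) :
  (40 * (390 + 2) + 136)%N%:R ^+ 2 / 9 / 47 + 81 / 10 <= (5 * 10 ^ 7)%N%:R / 80 :> R.
Proof.
rewrite [(_ + 136)%N%:R]natrD [(40 * _)%N%:R]natrM [(390 + 2)%N%:R]natrD.
by rewrite [(5 * _)%N%:R]natrM natrX; lra.
Qed.

Lemma kappa_gt1 : (1 < 5 * 10 ^ 7)%N.
Proof.
have h : (5 <= 5 * 10 ^ 7)%N by apply: leq_pmulr; rewrite expn_gt0.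
exact: leq_trans h.
Qed.

(** Rounding the number of strips up shrinks the cells. Beyond 390 strips it costs at most a factor
    [391 / 390] in the side, and [47 * (391 / 390) ^ 2 < 473 / 10]. *)
Lemma grid_scale (R : realType) (n k : R) : 0 < n -> 1 <= k ->
  exists I : nat, exists s : R,
    [/\ 0 < s, (40 * I)%:R * s = Num.sqrt n, 47 * s ^+ 2 <= k,
        (390 < I)%N -> k <= 473 / 10 * s ^+ 2 &
        (40 * I)%:R ^+ 2 <= 94 * n + 3200].
Proof.
move=> n0 k1; have k0 : 0 < k by lra.
pose y := Num.sqrt (47 * n / k) / 40.
have nk0 : 0 < 47 * n / k by rewrite divr_gt0 // mulr_gt0.
have y0 : 0 < y by rewrite divr_gt0 // sqrtr_gt0.
pose I := (Num.truncn y).+1.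
have /andP[Iy yI] : I.-1%:R <= y < I%:R by exact: truncn_itv (ltW y0).
pose s := Num.sqrt n / (40 * I)%:R.
have I0 : 0 < (40 * I)%:R :> R by rewrite ltr0n.
have sn : 0 < Num.sqrt n by rewrite sqrtr_gt0.
have IE : (40 * I)%:R = 40 * I%:R :> R by rewrite natrM.
have Ny : (40 * y) ^+ 2 * k = 47 * n.
  rewrite /y mulrCA mulfV // mulr1 sqr_sqrtr ?(ltW nk0) // divfK //.
  by rewrite gt_eqF.
have s2 : s ^+ 2 * (40 * I%:R) ^+ 2 = n.
  by rewrite -IE /s -exprMn divfK ?gt_eqF // sqr_sqrtr // ltW.
have I1 : 1 <= I%:R :> R by rewrite ler1n.
have IS : I%:R = I.-1%:R + 1 :> R by rewrite natr1.
exists I, s; split.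
- by rewrite divr_gt0.
- by rewrite mulrC divfK // gt_eqF.
- have : (40 * y) ^+ 2 <= (40 * I%:R) ^+ 2.
    by rewrite ler_sqr ?nnegrE; lra.
  move=> yI2; rewrite -(@ler_pM2r _ ((40 * I%:R) ^+ 2)); last first.
    by rewrite exprn_gt0 //; lra.
  by rewrite -mulrA s2 -Ny mulrC ler_pM2l.
- move=> I390; have I390' : 391 <= I%:R :> R by rewrite ler_nat.
  have yI2 : 40 * I%:R <= 391 / 390 * (40 * y) by lra.
  have : (40 * I%:R) ^+ 2 <= (391 / 390 * (40 * y)) ^+ 2.
    by rewrite ler_sqr ?nnegrE; lra.
  rewrite [X in _ <= X]exprMn => h; rewrite -(@ler_pM2r _ ((40 * I%:R) ^+ 2)); last first.
    by rewrite exprn_gt0 //; lra.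
  rewrite -[leRHS]mulrA s2; apply: (@le_trans _ _ (k * ((391 / 390) ^+ 2 * (40 * y) ^+ 2))).
    by rewrite ler_pM2l.
  by rewrite mulrCA [k * _]mulrC Ny; lra.
- rewrite IE; have : (40 * I%:R) ^+ 2 <= (40 * y + 40) ^+ 2.
    by rewrite ler_sqr ?nnegrE; lra.
  have : (40 * y) ^+ 2 <= 47 * n.
    by rewrite -Ny ler_peMr // sqr_ge0.
  have := sqr_ge0 (40 * y - 40); rewrite sqrrB sqrrD; lra.
Qed.

(** From [8 * k >= ln n], the exponent [81 / 10 * k] is at least [(1 + 1 / 80) * ln n], which beats
    the number of cells. *)
Lemma dense_bound (R : realType) (C n k M2 : R) :
  0 <= C -> 1 <= n -> ln n <= 8 * k -> M2 <= 94 * n + 3200 ->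
  C * M2 * expR (- (81 / 10 * k)) <= C * 3300 * expR (- (ln n / 80)).
Proof.
move=> C0 n1 nk Mn; rewrite -[leLHS]mulrA -[leRHS]mulrA ler_wpM2l //.
apply: (@le_trans _ _ (3300 * n * expR (- (81 / 10 * k)))).
  by rewrite ler_wpM2r ?expR_ge0 //; lra.
rewrite -mulrA; apply: ler_wpM2l; first exact: ler0n.
rewrite -[X in X * _](lnK (x := n)) ?posrE; last by lra.
by rewrite -expRD ler_expR; lra.
Qed.

Lemma dense_regime_gen (R : realType) (kappa J : nat) :
  (1 < kappa)%N -> J = 390%N -> 81 / 10 <= 21 / 1000 * J%:R :> R ->
  (40 * (J + 2) + 136)%N%:R ^+ 2 / 9 / 47 + 81 / 10 <= kappa%:R / 80 :> R ->
  exists2 C : R, 0 <= C &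
  forall (d : measure_display) (T : measurableType d) (P : probability T R)
    (X : T -> {fset R * R}) (n k : nat),
  poisson_process P (square (Num.sqrt (n%:R : R))) X ->
  (0 < n)%N -> (0 < k)%N -> ln n%:R <= 8 * k%:R :> R ->
  exists E : set T, [/\ measurable E,
    (P E <= (C * expR (- (ln n%:R / 80)))%:E)%E &
    forall w, ~ E w -> kappa_connected kappa (@knn_graph R k (X w)) ->
      hamiltonian (@knn_graph R k (X w))].
Proof.
move=> kappa1 JE hJ hK; have [C C0 HC] := grid_ok_prob hJ hK.
exists (C * 3300); first exact: mulr_ge0 C0 (ler0n _ _).
move=> d T P X n k PX n0 k0 nk.
have n1R : 1 <= n%:R :> R by rewrite ler1n.
have n0R : 0 < n%:R :> R by rewrite ltr0n.
have k1R : 1 <= k%:R :> R by rewrite ler1n.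
have [I [s [s0 sE sk ks sI]]] := grid_scale n0R k1R.
rewrite -sE in PX.
have {}ks : (J < I)%N -> k%:R <= 473 / 10 * s ^+ 2 by move=> JI; apply: ks; rewrite -JE.
have [E [mE PE goodE]] := HC _ _ _ _ _ _ _ s0 PX k0 sk ks.
exists E; split; first exact: mE.
  by apply: le_trans PE _; rewrite lee_fin; exact: dense_bound.
move=> w /goodE[gX win frames] conn.
exact: (grid_hamiltonian s0 gX kappa1 k0 (leqnn _) win frames conn).
Qed.

(** * Sparse regime *)

Definition independent_counts (R : realType) (d : measure_display)
    (T : measurableType d) (P : probability T R) (I : finType)
    (N : I -> T -> nat) : Prop :=
  (forall i (U : set nat), measurable (N i @^-1` U)) /\
  forall U : I -> set nat,
    fine (P (\bigcap_(i in [set: I]) (N i @^-1` U i))) =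
    \prod_i fine (P (N i @^-1` U i)).

Lemma fine_probability (R : realType) (d : measure_display)
    (T : measurableType d) (P : probability T R) (A : set T) :
  measurable A -> P A = (fine (P A))%:E.
Proof. by move=> mA; rewrite fineK // fin_num_measure. Qed.

Lemma independent_regions (R : realType) (d : measure_display)
    (T : measurableType d) (P : probability T R) (X : T -> {fset R * R})
    (s : R) (M : nat) (I : finType) (B : I -> pred (nat * nat)) :
  0 < s -> poisson_process P (square (M%:R * s)) X ->
  (forall i j c, B i c -> B j c -> i = j) ->
  independent_counts P (fun i => npoints X (region s M (B i))).
Proof.
move=> s0 PX Bdisj; split.
  by move=> i U; exact: measurable_npoints PX (measurable_region _ _ _).
move=> U; have [_ _ _ ind] := PX.
have := ind #|I| (fun j => region s M (B (enum_val j)))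
  (fun j => measurable_region _ _ _).
have tri : trivIset setT (fun j : 'I_#|I| => region s M (B (enum_val j))).
  move=> j j' _ _ [p [/(regionP _ _ _ s0)[_ _ p1 _] /(regionP _ _ _ s0)[_ _ p2 _]]].
  exact: enum_val_inj (Bdisj _ _ _ p1 p2).
move=> /(_ tri (fun j => U (enum_val j))) E.
have -> : \bigcap_(i in [set: I]) (npoints X (region s M (B i)) @^-1` U i) =
    \bigcap_(j in [set: 'I_#|I|])
      (npoints X (region s M (B (enum_val j))) @^-1` U (enum_val j)).
  apply/seteqP; split=> w Nw; first by move=> j _; exact: Nw.
  by move=> i _; rewrite -(enum_rankK i); exact: Nw.
rewrite E (eq_bigr (fun j : 'I_#|I| =>
  (fine (P (npoints X (region s M (B (enum_val j))) @^-1` U (enum_val j))))%:E)).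
  by rewrite prodEFin /= [RHS](reindex _ (onW_bij _ (enum_val_bij I))).
move=> j _; apply: fine_probability.
exact: measurable_npoints PX (measurable_region _ _ _).
Qed.

(** The additional constraints [U] make the induction work: [P (A minus E b)] is
    [P A - P (A and E b)], and intersecting with [E b] only replaces [U] by [V] on the block [b]. *)
Lemma independent_blocks (R : realType) (d : measure_display)
    (T : measurableType d) (P : probability T R) (I J : finType) (f : I -> J)
    (N : I -> T -> nat) (V : I -> set nat) :
  independent_counts P N ->
  let E b := \bigcap_(i in [set i | f i = b]) (N i @^-1` V i) in
  forall (r : seq J) (U : I -> set nat), uniq r ->
    (forall i, f i \in r -> U i = setT) ->
  fine (P ((\bigcap_(b in [set` r]) ~` E b) `&`
     \bigcap_(i in [set: I]) (N i @^-1` U i))) =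
  \prod_(b <- r) (1 - \prod_(i | f i == b) fine (P (N i @^-1` V i))) *
  \prod_i fine (P (N i @^-1` U i)).
Proof.
move=> [mN ind] E; have mE b : measurable (E b).
  by apply: fin_bigcap_measurable => // i _; exact: mN.
have mR U : measurable (\bigcap_(i in [set: I]) (N i @^-1` U i)).
  by apply: fin_bigcap_measurable => // i _; exact: mN.
have mC r : measurable (\bigcap_(b in [set` r]) ~` E b).
  by apply: fin_bigcap_measurable => // b _; exact: measurableC.
elim=> [|b r IHr] U.
  by move=> _ _; rewrite big_nil mul1r set_nil bigcap_set0 setTI ind.
move=> /= /andP[br ur] Ur.
have -> : \bigcap_(b' in [set` b :: r]) ~` E b' =
    ~` E b `&` \bigcap_(b' in [set` r]) ~` E b'.
  apply/seteqP; split=> w.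
    move=> rw; split; first by apply: rw; rewrite /= mem_head.
    by move=> b' b'r; apply: rw; rewrite /= inE; apply/orP; right.
  by move=> [bw rw] b' /=; rewrite inE => /predU1P[->|b'r]; [exact: bw|exact: rw].
rewrite -setIA; set A := (\bigcap_(b' in [set` r]) ~` E b') `&` _.
have mA : measurable A by apply: measurableI; [exact: mC|exact: mR].
have -> : ~` E b `&` A = A `\` E b by rewrite setIC setDE.
pose U' i := if f i == b then V i else U i.
have AE : A `&` E b = (\bigcap_(b in [set` r]) ~` E b) `&`
    \bigcap_(i in [set: I]) (N i @^-1` U' i).
  rewrite /A -setIA; congr (_ `&` _); apply/seteqP; split=> w.
    by move=> [Uw Ew] i _; rewrite /U' /=; case: eqP => [fi|_]; [exact: Ew|exact: Uw].
  move=> Uw; split=> i /=.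
    move=> _; have := Uw i Logic.I; rewrite /U' /=; case: eqP => // fi _.
    by rewrite Ur // fi mem_head.
  by move=> fi; have := Uw i Logic.I; rewrite /U' /= fi eqxx.
have -> : fine (P (A `\` E b)) = fine (P A) - fine (P (A `&` E b)).
  have -> : (P (A `\` E b) = P A - P (A `&` E b))%E.
    apply: measureD => //; exact: le_lt_trans (probability_le1 P mA) (ltry 1).
  rewrite (fine_probability P mA) (fine_probability P (measurableI _ _ mA (mE b))).
  by [].
have UT i : f i \in r -> U i = setT by move=> ir; apply: Ur; rewrite inE ir orbT.
have U'T i : f i \in r -> U' i = setT.
  move=> ir; rewrite /U'; case: eqP => [fi|_]; last exact: UT.
  by move: br; rewrite -fi ir.
rewrite AE /A (IHr U ur UT) (IHr U' ur U'T).
have UE : \prod_i fine (P (N i @^-1` U i)) =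
    \prod_(i | f i != b) fine (P (N i @^-1` U i)).
  rewrite (bigID (fun i => f i == b)) /= big1 ?mul1r // => i /eqP fi.
  by rewrite Ur ?fi ?mem_head // preimage_setT probability_setT.
have U'E : \prod_i fine (P (N i @^-1` U' i)) =
    \prod_(i | f i == b) fine (P (N i @^-1` V i)) *
    \prod_(i | f i != b) fine (P (N i @^-1` U i)).
  rewrite (bigID (fun i => f i == b)) /=; congr (_ * _); apply: eq_bigr => i.
    by rewrite /U' => ->.
  by rewrite /U' => /negPf ->.
by rewrite big_cons U'E UE; ring.
Qed.

Lemma independent_blocks_avoid (R : realType) (d : measure_display)
    (T : measurableType d) (P : probability T R) (I J : finType) (f : I -> J)
    (N : I -> T -> nat) (V : I -> set nat) (p : R) :
  independent_counts P N -> 0 <= p ->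
  (forall b, p <= \prod_(i | f i == b) fine (P (N i @^-1` V i))) ->
  measurable (\bigcap_(b in [set: J])
    ~` \bigcap_(i in [set i | f i = b]) (N i @^-1` V i)) /\
  (P (\bigcap_(b in [set: J]) ~` \bigcap_(i in [set i | f i = b]) (N i @^-1` V i)) <=
    (expR (- (p * #|J|%:R)))%:E)%E.
Proof.
move=> NI p0 pV; have [mN _] := NI.
set A := \bigcap_(b in _) _.
have mA : measurable A.
  apply: fin_bigcap_measurable => // b _; apply: measurableC.
  by apply: fin_bigcap_measurable => // i _; exact: mN.
split=> //; rewrite (fine_probability P mA) lee_fin.
have AE : A = (\bigcap_(b in [set` enum J])
      ~` \bigcap_(i in [set i | f i = b]) (N i @^-1` V i)) `&`
    \bigcap_(i in [set: I]) (N i @^-1` setT).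
  apply/seteqP; split=> w; last by move=> [Aw _] b _; apply: Aw; rewrite /= mem_enum.
  by move=> Aw; split=> // b _; exact: Aw.
have -> : fine (P A) = \prod_b (1 - \prod_(i | f i == b) fine (P (N i @^-1` V i))).
  rewrite AE (independent_blocks (f := f) V NI (r := enum J) (U := fun=> setT)) ?enum_uniq //.
  rewrite [X in _ * X]big1 ?mulr1; last first.
    by move=> i _; rewrite preimage_setT probability_setT.
  by rewrite big_enum.
apply: (@le_trans _ _ (\prod_(b : J) expR (- p))).
  apply: ler_prod => b _; apply/andP; split.
    rewrite subr_ge0; apply: prodr_ile1 => i _; rewrite fine_ge0 ?measure_ge0 //=.
    by rewrite -lee_fin -(fine_probability P (mN i _)) probability_le1.
  apply: le_trans (expR_ge1Dx _); rewrite lerD2l lerN2; exact: pV.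
by rewrite prodr_const -expRM_natl ler_expR cardT -cardE; lra.
Qed.

(** * Lower bounds for isolated blocks *)

(** A crude form of Stirling's formula; the induction step is
    [(u / (u + 1)) ^ (u + 1) <= expR (-1)]. *)
Lemma fact_le_pow (R : realType) (t : nat) : (0 < t)%N ->
  t`!%:R <= t%:R ^+ t.+1 * expR (1 - t%:R) :> R.
Proof.
elim: t => // -[|t] IHt _; first by rewrite subrr expR0 mulr1 expr1n.
have {}IHt := IHt isT; set u := t.+1 in IHt *.
have u0 : 0 < u%:R :> R by rewrite ltr0n.
have u10 : 0 < u.+1%:R :> R by rewrite ltr0n.
rewrite factS natrM.
apply: (@le_trans _ _ (u.+1%:R * (u%:R ^+ u.+1 * expR (1 - u%:R)))).
  by rewrite ler_pM2l.
rewrite [u.+1%:R ^+ u.+2]exprS -[leRHS]mulrA ler_pM2l //.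
have -> : 1 - u%:R = 1 + (1 - u.+1%:R) :> R by rewrite -natr1; ring.
rewrite expRD mulrA ler_wpM2r ?expR_ge0 //.
have h : u%:R / u.+1%:R <= expR (- u.+1%:R^-1) :> R.
  apply: le_trans (expR_ge1Dx _); rewrite ler_pdivrMr // mulrDl mul1r.
  by rewrite mulNr mulVf ?gt_eqF // -natr1; lra.
have : (u%:R / u.+1%:R) ^+ u.+1 <= expR (- u.+1%:R^-1) ^+ u.+1 :> R.
  by rewrite lerXn2r ?nnegrE ?expR_ge0 // divr_ge0 ?ler0n.
rewrite -expRM_natl mulrN mulfV ?gt_eqF // expRN expr_div_n ler_pdivrMr ?exprn_gt0 //.
by rewrite mulrC ler_pdivlMr ?expR_gt0.
Qed.

Lemma poisson_pmf_ge (R : realType) (mu y : R) (t : nat) : 0 < mu -> (0 < t)%N ->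
  expR y <= mu / t%:R ->
  expR (t%:R * (y + 1) - 1 - mu) / t%:R <= poisson_pmf mu t.
Proof.
move=> mu0 t0 ymu; have tR : 0 < t%:R :> R by rewrite ltr0n.
have f0 : 0 < t`!%:R :> R by rewrite ltr0n fact_gt0.
have key : expR (t%:R * (y + 1) - 1) * t`!%:R <= mu ^+ t * t%:R.
  apply: (@le_trans _ _ (expR (t%:R * (y + 1) - 1) * (t%:R ^+ t.+1 * expR (1 - t%:R)))).
    by rewrite ler_wpM2l ?expR_ge0 // fact_le_pow.
  rewrite mulrCA -expRD.
  have -> : t%:R * (y + 1) - 1 + (1 - t%:R) = t%:R * y by ring.
  rewrite expRM_natl exprS -mulrA [leRHS]mulrC ler_pM2l // -exprMn.
  rewrite lerXn2r ?nnegrE ?mulr_ge0 ?expR_ge0 ?ler0n ?(ltW mu0) //.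
  by rewrite mulrC -ler_pdivlMr.
rewrite /poisson_pmf mu0 expRD ler_pdivrMr //.
rewrite [leRHS](_ : _ = mu ^+ t * t%:R / t`!%:R * expR (- mu)); last by ring.
by rewrite ler_wpM2r ?expR_ge0 // ler_pdivlMr.
Qed.

(** Across a block the widths are [7 + 10 + 7 + 10 + 7 = 41]: ring, moat, center, moat, ring. *)
Definition ring_cell (u : nat * nat) : bool := ~~ box 7 7 27 27 u.

Definition piece_index : finType := (bool + 'I_41 * 'I_41)%type.

(* [inr u] is empty, and [piece_count] imposes nothing on it, when the cell [u]
   lies in the moat or in the center. *)
Definition piece (b : nat * nat) (x : piece_index) : pred (nat * nat) :=
  let center := box (41 * b.1 + 17)%N (41 * b.2 + 17)%N 7 7 in
  let moat := box (41 * b.1 + 7)%N (41 * b.2 + 7)%N 27 27 in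
  match x with
  | inl true => center
  | inl false => [pred c | moat c && ~~ center c]
  | inr u => [pred c | (c == (41 * b.1 + u.1, 41 * b.2 + u.2)%N) && ~~ moat c]
  end.

Definition piece_count (t0 t : nat) (x : piece_index) : set nat :=
  match x with
  | inl true => [set m | (t0 <= m)%N]
  | inl false => [set 0%N]
  | inr u => if ring_cell (val u.1, val u.2) then [set m | (t <= m)%N] else setT
  end.

Lemma piece_disjoint (b b' : nat * nat) (x x' : piece_index) (c : nat * nat) :
  piece b x c -> piece b' x' c -> b = b' /\ x = x'.
Proof.
have inbox (a : nat * nat) y : piece a y c -> (c.1 %/ 41 = a.1 /\ c.2 %/ 41 = a.2)%N.
  case: y => [[]|[u v]]; rewrite /piece /box /=.
  - by clear; lia.
  - by clear; lia.
  - by case: c => c1 c2 /= /andP[/eqP[-> ->] _]; have := ltn_ord u; have := ltn_ord v;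
      clear; lia.
move=> h h'; have [e1 e2] := inbox _ _ h; have [e1' e2'] := inbox _ _ h'.
have bE : b = b' by case: (b) (b') e1 e2 e1' e2' => ? ? [? ?] /= -> -> -> ->.
subst b'; split=> //; move: h h'; rewrite /piece.
case: x x' => [[]|[u v]] [[]|[u' v']] //=.
- by move=> -> /andP[].
- by move=> h /andP[_]; move: h; rewrite /box /=; clear; lia.
- by move=> /andP[_ /negPf ->].
- by move=> /andP[-> _] /andP[].
- by move=> /andP[_ h] h'; move: h' h; rewrite /box /=; clear; lia.
- by move=> /andP[_ /negP h] /andP[].
move=> /andP[/eqP-> _] /andP[/eqP[/addnI uu' /addnI vv'] _].
by congr (inr (_, _)); apply: val_inj.
Qed.

Lemma half_expR1 (R : realType) : expR (-1) <= 1 / 2 :> R.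
Proof.
rewrite expRN div1r lef_pV2 ?posrE ?expR_gt0 //.
by apply: le_trans (expR_ge1Dx _); lra.
Qed.

(** The mean is at least [L / 710], slightly above the threshold near [L / 728], where
    [728 = 8 * 91]. The margin suffices only because [L] is at least [10 ^+ 8]. *)
Lemma poisson_half (R : realType) (mu L : R) (t : nat) : 0 <= mu ->
  L <= 710 * mu -> t%:R <= L / 728 + 2 -> 10 ^+ 8 <= L ->
  1 / 2 <= fine (poisson_prob mu 0 [set m | (t <= m)%N]).
Proof.
move=> mu0 Lmu tL L0.
have le1 : (poisson_prob mu 0 (~` [set m | (t <= m)%N]) <= (1 / 2)%:E)%E.
  apply: le_trans (poisson_chernoff (a := - (1 / 50)) (t := t%:R) mu0 _) _.
    move=> j /= /negP; rewrite -ltnNge => jt.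
    by rewrite ler_nM2l ?ler_nat ?oppr_lt0 ?divr_gt0 // ltnW.
  rewrite lee_fin; apply: le_trans (half_expR1 R); rewrite ler_expR.
  have h : expR (- (1 / 50)) <= 50 / 51 :> R.
    rewrite expRN -[leRHS]invrK invf_div lef_pV2 ?posrE ?expR_gt0 //.
    by apply: le_trans (expR_ge1Dx _); lra.
  have : 0 <= mu * (50 / 51 - expR (- (1 / 50))) by apply: mulr_ge0; lra.
  by lra.
have := probability_setC (poisson_prob mu 0) (A := [set m | (t <= m)%N]) Logic.I.
rewrite -[X in (1 - X)%E](fineK (fin_num_measure _ _ _)) //.
move: le1; rewrite -[X in (X <= _)%E -> _](fineK (fin_num_measure _ _ _)) // lee_fin.
move=> le1 E.
have {}E : fine (poisson_prob mu 0 (~` [set m | (t <= m)%N])) =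
   1 - fine (poisson_prob mu 0 [set m | (t <= m)%N]) by rewrite E.
by move: le1; rewrite E; lra.
Qed.

Lemma size_moat (M i j : nat) : (i + 27 <= M)%N -> (j + 27 <= M)%N ->
  size (cells M [pred c | box i j 27 27 c &&
    ~~ box (i + 10)%N (j + 10)%N 7 7 c]) = 680%N.
Proof.
move=> iM jM.
have := size_cells_box_in iM jM.
have := @size_cells_box_in M (i + 10)%N (j + 10)%N 7 7.
move=> /(_ (ltac:(lia)) (ltac:(lia))).
rewrite /cells !size_filter => c1 c2.
have := count_predUI [pred c | box i j 27 27 c && ~~ box (i + 10)%N (j + 10)%N 7 7 c]
  (box (i + 10)%N (j + 10)%N 7 7) [seq (i, j) | i <- iota 0 M, j <- iota 0 M].
rewrite (eq_count (a1 := predI _ _) (a2 := pred0)); last first.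
  by move=> c /=; rewrite andbAC -andbA andbN andbF.
rewrite count_pred0 addn0 c1 (eq_count (a2 := box i j 27 27)); last first.
  by move=> c; rewrite /box /=; apply/idP/idP; clear; lia.
by rewrite c2 => h; apply/eqP; rewrite -(eqn_add2r (7 * 7)%N) -h.
Qed.

Lemma big_fst (R : comNzRingType) (J K : finType) (b : J) (F : J * K -> R) :
  \prod_(i | i.1 == b) F i = \prod_x F (b, x).
Proof.
rewrite (reindex_onto (fun x => (b, x)) snd) /=; last by move=> [j x] /= /eqP ->.
by apply: eq_bigl => x; rewrite !eqxx.
Qed.

Lemma size_center (M : nat) (b : nat * nat) : (41 * b.1 + 41 <= M)%N ->
  (41 * b.2 + 41 <= M)%N -> size (cells M (piece b (inl true))) = (7 * 7)%N.
Proof.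
move=> b1 b2; apply: size_cells_box_in; first by move: b1; clear; lia.
by move: b2; clear; lia.
Qed.

Lemma size_moat_piece (M : nat) (b : nat * nat) : (41 * b.1 + 41 <= M)%N ->
  (41 * b.2 + 41 <= M)%N -> size (cells M (piece b (inl false))) = 680%N.
Proof.
move=> b1 b2; apply: etrans (@size_moat M (41 * b.1 + 7)%N (41 * b.2 + 7)%N _ _); last 2 first.
- by move: b1; clear; lia.
- by move: b2; clear; lia.
congr size; apply: eq_filter => c; rewrite /piece /box /=.
by apply/idP/idP; clear; lia.
Qed.

Lemma size_ring_piece (M : nat) (b : nat * nat) (u : 'I_41 * 'I_41) :
  (41 * b.1 + 41 <= M)%N -> (41 * b.2 + 41 <= M)%N ->
  ring_cell (val u.1, val u.2) -> size (cells M (piece b (inr u))) = 1%N.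
Proof.
move=> b1 b2 uv.
apply: etrans (@size_cells1 M (41 * b.1 + u.1, 41 * b.2 + u.2)%N _ _); last 2 first.
- by move=> /=; have := ltn_ord u.1; move: b1; clear; lia.
- by move=> /=; have := ltn_ord u.2; move: b2; clear; lia.
congr size; apply: eq_filter => c; apply/idP/idP => [/andP[]//|/eqP ->].
apply/andP; split; first exact: eqxx.
by move: uv; rewrite /ring_cell /box /=; clear; lia.
Qed.

(** The factors are a crowded center, an empty moat of [27 ^ 2 - 7 ^ 2 = 680] cells, and [1 / 2] for
    each of the [41 * 41] positions. Positions outside the ring carry no condition, so [1 / 2] is a
    valid lower bound there too. *)
Lemma prob_pieces (R : realType) (d : measure_display)
    (T : measurableType d) (P : probability T R) (X : T -> {fset R * R})
    (s : R) (I t0 t : nat) (b : 'I_I * 'I_I) :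
  0 < s -> poisson_process P (square ((41 * I)%:R * s)) X -> (0 < t0)%N ->
  expR (- (61 / 100)) <= 49 * s ^+ 2 / t0%:R ->
  1 / 2 <= fine (poisson_prob (s ^+ 2) 0 [set m | (t <= m)%N]) ->
  expR (t0%:R * (- (61 / 100) + 1) - 1 - 49 * s ^+ 2) / t0%:R *
    expR (- (680 * s ^+ 2)) * (1 / 2) ^+ (41 * 41) <=
  \prod_(i : ('I_I * 'I_I) * piece_index | i.1 == b)
    fine (P (npoints X (region s (41 * I)%N (piece (val i.1.1, val i.1.2) i.2))
      @^-1` piece_count t0 t i.2)).
Proof.
move=> s0 PX t00 et0 ht; rewrite big_fst big_sumType big_bool /=.
set M := (41 * I)%N.
have b1 := ltn_ord b.1; have b2 := ltn_ord b.2.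
have pmf0 : 0 <= expR (t0%:R * (- (61 / 100) + 1) - 1 - 49 * s ^+ 2) / t0%:R.
  by rewrite divr_ge0 ?expR_ge0 ?ler0n.
have s2 : 0 < s ^+ 2 by rewrite exprn_gt0.
have B1 : (41 * (val b.1, val b.2).1 + 41 <= M)%N by rewrite /M /= -mulnSr leq_mul2l.
have B2 : (41 * (val b.1, val b.2).2 + 41 <= M)%N by rewrite /M /= -mulnSr leq_mul2l.
have mu0 : 0 < (7 * 7)%N%:R * s ^+ 2 by apply: mulr_gt0; rewrite // ltr0n.
apply: ler_pM.
- by apply: mulr_ge0; [exact: pmf0 | exact: expR_ge0].
- by apply: exprn_ge0; lra.
- apply: ler_pM; [exact: pmf0 | exact: expR_ge0 | |].
    rewrite (poisson_process_region _ _ s0 PX) (size_center B1 B2).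
    apply: le_trans (poisson_pmf_ge mu0 t00 et0) _.
    rewrite -lee_fin (fineK (fin_num_measure _ _ _)); last by [].
    exact: poisson_prob_ge mu0 (leqnn t0).
  rewrite (poisson_process_region _ _ s0 PX) (size_moat_piece B1 B2).
  rewrite poisson_prob0; first exact: lexx.
  by apply: mulr_gt0; [rewrite ltr0n | exact: s2].
have <- : #|{: 'I_41 * 'I_41}| = (41 * 41)%N by rewrite card_prod !card_ord.
rewrite -prodr_const; apply: ler_prod => u _; apply/andP; split; first by lra.
rewrite /piece_count; case: ifPn => uv; last first.
  by rewrite preimage_setT probability_setT /=; lra.
rewrite (poisson_process_region _ _ s0 PX) (size_ring_piece B1 B2 uv).
rewrite -[s ^+ 2]mul1r in ht.
exact: ht.
Qed.

(** A large [L] yields at least 500 blocks per side, so rounding costs a factor [501 / 500] in the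
    cell side, and [707 * (501 / 500) ^ 2 < 710]. *)
Lemma sparse_scale (R : realType) (n L : R) : n = expR L -> 10 ^+ 8 <= L ->
  exists I : nat, exists s : R,
    [/\ 0 < s, (41 * I)%:R * s = Num.sqrt n, 707 * s ^+ 2 <= L,
        L <= 710 * s ^+ 2 & 707 * n <= L * (1681 * I%:R ^+ 2)].
Proof.
move=> nE L8; have L0 : 0 < L by lra.
have n0 : 0 < n by rewrite nE expR_gt0.
have [m mE] : exists m : R, m = 707 * n by exists (707 * n).
have m0 : 0 < m by lra.
pose y := Num.sqrt (m / L) / 41.
have nL0 : 0 < m / L by apply: divr_gt0.
have y0 : 0 < y by apply: divr_gt0; [rewrite sqrtr_gt0|lra].
have Ny : (41 * y) ^+ 2 * L = m.
  rewrite /y mulrCA mulfV; last by lra.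
  by rewrite mulr1 sqr_sqrtr ?(ltW nL0) // divfK //; lra.
have y500 : 500 <= y.
  have hn : L / 2 * (L / 2) <= n.
    have := @expR_ge_pow R (L / 2) 2 (ltac:(lra)).
    rewrite [2%:R * _]mulrC divfK; last by rewrite pnatr_eq0.
    by rewrite -nE; apply: le_trans; rewrite expr2; lra.
  have hL : 5 * 10 ^+ 6 * L <= n.
    have : 0 <= (L - 10 ^+ 8) * L by apply: mulr_ge0; lra.
    by lra.
  rewrite -(@ler_sqr _ 500) ?nnegrE; [|lra|lra].
  rewrite -(@ler_pM2r _ L L0); move: Ny; rewrite exprMn; lra.
pose I := (Num.truncn y).+1.
have /andP[Iy yI] : I.-1%:R <= y < I%:R by exact: truncn_itv (ltW y0).
pose s := Num.sqrt n / (41 * I)%:R.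
have I0 : 0 < (41 * I)%:R :> R by rewrite ltr0n.
have sn : 0 < Num.sqrt n by rewrite sqrtr_gt0.
have IE : (41 * I)%:R = 41 * I%:R :> R by rewrite natrM.
have s2 : s ^+ 2 * (41 * I%:R) ^+ 2 = n.
  by rewrite -IE /s -exprMn divfK ?gt_eqF // sqr_sqrtr // ltW.
have IS : I%:R = I.-1%:R + 1 :> R by rewrite natr1.
have I2 : 0 < (41 * I%:R) ^+ 2 :> R by rewrite exprn_gt0 //; lra.
have yI2 : (41 * y) ^+ 2 <= (41 * I%:R) ^+ 2 by rewrite ler_sqr ?nnegrE; lra.
exists I, s; split.
- by rewrite divr_gt0.
- by rewrite mulrC divfK // gt_eqF.
- rewrite -(@ler_pM2r _ ((41 * I%:R) ^+ 2)) //.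
  by rewrite -mulrA s2 -mE -Ny mulrC ler_pM2l.
- have : (41 * I%:R) ^+ 2 <= (501 / 500 * (41 * y)) ^+ 2.
    by rewrite ler_sqr ?nnegrE; lra.
  rewrite [X in _ <= X]exprMn => h; rewrite -(@ler_pM2r _ ((41 * I%:R) ^+ 2)) //.
  rewrite -[leRHS]mulrA s2; apply: (@le_trans _ _ (L * ((501 / 500) ^+ 2 * (41 * y) ^+ 2))).
    by rewrite ler_pM2l.
  by rewrite mulrCA [L * _]mulrC Ny; lra.
- rewrite -mE -Ny mulrC ler_pM2l //; apply: le_trans yI2 _.
  by rewrite exprMn; lra.
Qed.

Lemma cube_le_expR (R : realType) (x : R) : 0 <= x -> x ^+ 3 / 27 <= expR x.
Proof.
move=> x0; have := @expR_ge_pow R (x / 3) 3 (ltac:(lra)).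
rewrite [3%:R * _]mulrC divfK; last by rewrite pnatr_eq0.
apply: le_trans.
have := exprn_ge0 2 x0; rewrite !exprS expr0; lra.
Qed.

Lemma crowded_growth (R : realType) (a c L J n : R) : 1 - a = 176 / 10 ^+ 4 ->
  0 < c -> 0 < L -> 10 ^+ 8 <= L * c -> n = expR L -> n <= 3 * (L * J) ->
  L <= expR (- (L * a)) * (c * J).
Proof.
move=> aE c0 L0 cL nE nJ.
have LJ : expR (L * (1 - a)) <= expR (- (L * a)) * (3 * (L * J)).
  have -> : L * (1 - a) = - (L * a) + L by ring.
  by rewrite expRD -nE ler_wpM2l ?expR_ge0.
have hv : 10 ^+ 5 * (L / 10 ^+ 4) ^+ 3 <= expR (L * (1 - a)).
  apply: le_trans (cube_le_expR _); last by apply: mulr_ge0; lra.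
  have -> : L * (1 - a) = 176 * (L / 10 ^+ 4) by rewrite aE; lra.
  have := exprn_ge0 3 (ltac:(lra) : 0 <= L / 10 ^+ 4).
  by rewrite exprMn; lra.
rewrite -(@ler_pM2r _ (3 * L)); last by lra.
apply: (@le_trans _ _ (c * (10 ^+ 5 * (L / 10 ^+ 4) ^+ 3))); last first.
  apply: (@le_trans _ _ (c * (expR (- (L * a)) * (3 * (L * J))))).
    by rewrite ler_pM2l //; apply: le_trans LJ.
  by rewrite le_eqVlt; apply/orP; left; apply/eqP; ring.
have h : 10 ^+ 8 * L ^+ 2 <= L * c * L ^+ 2 by rewrite ler_wpM2r ?sqr_ge0.
have := sqr_ge0 L; rewrite expr2.
by rewrite expr_div_n -exprM [L ^+ 3]exprS; lra.
Qed.

(** The expected number of isolated blocks is bounded below. Emptiness of moat and center would cost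
    the exponent [729 / 707], and crowding the center wins back [39 / 100 * (1 / 8)]: the balance is
    just below [1 - 176 / 10 ^ 4]. The surplus power of [n] beats the powers of [L] and the constant
    [c]. *)
Lemma crowded_expectation (R : realType) (c L n s2 t0 J : R) : 0 < c -> c <= 1 ->
  10 ^+ 8 / c <= L -> n = expR L -> 707 * s2 <= L -> L / 8 <= t0 -> t0 <= L ->
  707 * n <= L * (1681 * J) ->
  1 <= expR (t0 * (- (61 / 100) + 1) - 1 - 49 * s2) / t0 * expR (- (680 * s2)) * c * J.
Proof.
move=> c0 c1 Lc nE sL t0L t0L' nJ.
have cL : 10 ^+ 8 <= L * c by rewrite -ler_pdivrMr.
have L8 : 10 ^+ 8 <= L.
  by apply: le_trans cL _; rewrite ler_piMr //; move: Lc; apply: le_trans; apply: divr_ge0; lra.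
have L0 : 0 < L by lra.
have t00 : 0 < t0 by lra.
have n0 : 0 < n by rewrite nE expR_gt0.
have J0 : 0 <= J.
  have : 0 <= L * (1681 * J) by lra.
  by rewrite pmulr_rge0 //; lra.
set a := expR (_ - _); set b := expR (- (680 * s2)).
have -> : a / t0 * b * c * J = a * b / t0 * (c * J) by ring.
rewrite /a /b -expRD {a b}.
have [q qE] : exists q : R, 1 - q = 176 / 10 ^+ 4.
  by exists (1 - 176 / 10 ^+ 4); lra.
have nJ' : n <= 3 * (L * J) by lra.
have hL := crowded_growth qE c0 L0 cL nE nJ'.
have cJ : 0 <= c * J by apply: mulr_ge0; lra.
rewrite mulrAC ler_pdivlMr // mul1r; apply: le_trans t0L' _.
apply: le_trans hL _; apply: ler_wpM2r => //.
rewrite ler_expR.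
have -> : q = 1 - 176 / 10 ^+ 4 by lra.
by lra.
Qed.

Lemma sparse_thresholds (R : realType) (L s2 : R) (k : nat) :
  10 ^+ 8 <= L -> L <= 710 * s2 -> 8 * k%:R < L ->
  exists t0 t : nat,
    [/\ [/\ (0 < t0)%N, (k < t0)%N & (k < 91 * t)%N], L / 8 <= t0%:R, t0%:R <= L,
        expR (- (61 / 100)) <= 49 * s2 / t0%:R & t%:R <= L / 728 + 2].
Proof.
move=> L8 Ls kL.
have [t0 [t0L Lt0]] : exists t0 : nat, L / 8 < t0%:R /\ t0%:R <= L / 8 + 1.
  have L0 : 0 <= L / 8 by lra.
  have /andP[a b] := truncn_itv L0; exists (Num.truncn (L / 8)).+1.
  by split=> //; rewrite -natr1; lra.
have t00 : 0 < t0%:R :> R by lra.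
have kt0 : (k < t0)%N by rewrite -(ltr_nat R); lra.
exists t0, (t0 %/ 91).+1; split.
- split=> //; first exact: leq_ltn_trans (leq0n k) kt0.
  by move: kt0; clear; lia.
- exact: ltW.
- by lra.
- rewrite ler_pdivlMr //; apply: (@le_trans _ _ (55 / 100 * t0%:R)); last by lra.
  rewrite ler_pM2r // expRN -[leRHS]invrK invf_div lef_pV2 ?posrE ?expR_gt0 //.
  have := @expR_ge_pow R (61 / 100 / 20) 20 (ltac:(lra)).
  rewrite [20%:R * _]mulrC divfK; last by rewrite pnatr_eq0.
  by apply: le_trans; lra.
- have h : (91 * (t0 %/ 91) <= t0)%N by clear; lia.
  have : (91 * (t0 %/ 91))%:R <= t0%:R :> R by rewrite ler_nat.
  by rewrite natrM -natr1; lra.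
Qed.

Lemma isolated_block (R : realType) (T : Type) (X : T -> {fset R * R}) (s : R)
    (I k t0 t kappa : nat) (b : 'I_I * 'I_I) (w : T) :
  0 < s -> in_grid s (41 * I) (X w) -> (0 < kappa)%N -> (k < t0)%N ->
  (k < 91 * t)%N ->
  (forall x : piece_index, piece_count t0 t x
    (npoints X (region s (41 * I)%N (piece (val b.1, val b.2) x)) w)) ->
  ~ kappa_connected kappa (@knn_graph R k (X w)).
Proof.
move=> s0 gX kappa0 kt0 kt pcs.
apply: (@isolated_square _ _ _ t (41 * b.1)%N (41 * b.2)%N s) => //.
- by move=> p pX; have /and4P[] := gX _ pX.
- have := pcs (inl true); rewrite npoints_in_cells //=.
  exact: leq_trans.
- move=> x bx; apply: contraT => nb.
  have := pcs (inl false); rewrite npoints_in_cells //= => /eqP.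
  by rewrite cards_eq0 => /eqP/setP/(_ x); rewrite !inE /= bx nb.
- case=> c1 c2 bc nb.
  have /andP[/andP[l1 u1] /andP[l2 u2]] : ((41 * b.1 <= c1 < 41 * b.1 + 41) &&
      (41 * b.2 <= c2 < 41 * b.2 + 41))%N by move: bc; rewrite /box /=; clear; lia.
  have v1 : (c1 - 41 * b.1 < 41)%N by move: l1 u1; clear; lia.
  have v2 : (c2 - 41 * b.2 < 41)%N by move: l2 u2; clear; lia.
  have := pcs (inr (Ordinal v1, Ordinal v2)).
  rewrite npoints_in_cells // /piece_count ifT; last first.
    by move: nb l1 l2; rewrite /ring_cell /box /=; clear; lia.
  move=> /leq_trans; apply; apply: subset_leq_card; apply/fintype.subsetP => x.
  rewrite !inE /= => /andP[/eqP -> _].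
  by rewrite !subnKC.
Qed.

Lemma sparse_regime (R : realType) :
  exists2 L0 : R, 0 < L0 &
  forall (d : measure_display) (T : measurableType d) (P : probability T R)
    (X : T -> {fset R * R}) (n k kappa : nat),
  poisson_process P (square (Num.sqrt (n%:R : R))) X ->
  (0 < kappa)%N -> L0 <= ln n%:R -> 8 * k%:R < ln n%:R :> R ->
  exists E : set T, [/\ measurable E, (P E <= (1 / 2)%:E)%E &
    forall w, ~ E w -> ~ kappa_connected kappa (@knn_graph R k (X w))].
Proof.
have [c [c0 c1 cE]] : exists c : R, [/\ 0 < c, c <= 1 & c = (1 / 2) ^+ (41 * 41)].
  exists ((1 / 2) ^+ (41 * 41)); split; last by [].
  - by apply: exprn_gt0; lra.
  - by apply: exprn_ile1; lra.
have e8 : 0 < 10 ^+ 8 :> R by apply: exprn_gt0; lra.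
exists (10 ^+ 8 / c); first exact: divr_gt0.
move=> d T P X n k kappa PX kappa0 Lc kL.
have [L LE] : exists L : R, L = ln n%:R by exists (ln n%:R).
rewrite -LE in Lc kL.
have L8 : 10 ^+ 8 <= L.
  by apply: le_trans Lc; rewrite ler_pdivlMr // ler_piMr // ltW.
have n0 : 0 < n%:R :> R.
  rewrite lt_def ler0n andbT; apply: contraTneq L8 => n0.
  by rewrite LE n0 ln0 // -ltNge.
have nE : n%:R = expR L by rewrite LE lnK.
have [I [s [s0 sE sL Ls nI]]] := sparse_scale nE L8.
rewrite -sE in PX; set M := (41 * I)%N in PX.
have [t0 [t [[t00 kt0 kt] Lt0 t0L et0 tL]]] := sparse_thresholds L8 Ls kL.
have s2 : 0 <= s ^+ 2 by exact: sqr_ge0.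
pose N (i : ('I_I * 'I_I) * piece_index) :=
  npoints X (region s M (piece (val i.1.1, val i.1.2) i.2)).
pose V (i : ('I_I * 'I_I) * piece_index) := piece_count t0 t i.2.
have indep : independent_counts P N.
  apply: independent_regions s0 PX _ => -[[i1 i2] x] [[j1 j2] y] u /= iu ju.
  have [[e1 e2] ->] := piece_disjoint iu ju.
  by rewrite (val_inj e1) (val_inj e2).
have [p [p0 pJ hp]] : exists p : R, [/\ 0 <= p, 1 <= p * #|{: 'I_I * 'I_I}|%:R &
    forall b, p <= \prod_(i | i.1 == b) fine (P (N i @^-1` V i))].
  exists (expR (t0%:R * (- (61 / 100) + 1) - 1 - 49 * s ^+ 2) / t0%:R *
    expR (- (680 * s ^+ 2)) * c); split.
  - apply: mulr_ge0; last exact: ltW.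
    apply: mulr_ge0; last exact: expR_ge0.
    by apply: divr_ge0; [exact: expR_ge0 | exact: ler0n].
  - rewrite card_prod !card_ord natrM -expr2.
    exact: crowded_expectation c0 c1 Lc nE sL Lt0 t0L nI.
  - move=> b; rewrite cE.
    exact: prob_pieces s0 PX t00 et0 (poisson_half s2 Ls tL L8).
have [mA PA] := independent_blocks_avoid indep p0 hp.
set A := \bigcap_(b in _) _ in mA PA.
have mG := measurable_grid_event s M PX; have G0 := prob_grid_event s0 PX.
exists (~` grid_event X s M `|` A); split.
- by apply: measurableU => //; exact: measurableC.
- apply: (@le_trans _ _ (P (~` grid_event X s M) + P A)%E).
    exact: measureU2 (measurableC mG) mA.
  rewrite G0 add0e; apply: le_trans PA _; rewrite lee_fin.
  by apply: le_trans (half_expR1 R); rewrite ler_expR lerN2.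
move=> w /not_orP[/contrapT gw Aw].
have gX := grid_event_in_grid s0 gw.
have [b hb] : exists b, (\bigcap_(i in [set i | i.1 = b]) (N i @^-1` V i)) w.
  by apply: contrapT => nb; apply: Aw => b _ hb; apply: nb; exists b.
apply: (@isolated_block R T X s I k t0 t kappa b w s0 gX kappa0 kt0 kt) => x.
exact: (hb (b, x) erefl).
Qed.

(** * Combination of the regimes *)

Lemma dense_regime (R : realType) : exists2 C : R, 0 <= C &
  forall (d : measure_display) (T : measurableType d) (P : probability T R)
    (X : T -> {fset R * R}) (n k : nat),
  poisson_process P (square (Num.sqrt (n%:R : R))) X ->
  (0 < n)%N -> (0 < k)%N -> ln n%:R <= 8 * k%:R :> R ->
  exists E : set T, [/\ measurable E,
    (P E <= (C * expR (- (ln n%:R / 80)))%:E)%E &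
    forall w, ~ E w -> kappa_connected (5 * 10 ^ 7)%N (@knn_graph R k (X w)) ->
      hamiltonian (@knn_graph R k (X w))].
Proof.
have h : 81 / 10 <= 21 / 1000 * 390%:R :> R by lra.
exact: (dense_regime_gen kappa_gt1 erefl h (window_constant R)).
Qed.

Lemma near_ln_ge (R : realType) (r : R) : \forall n \near \oo, r <= ln n%:R.
Proof.
exists (Num.truncn (expR r)).+1 => // n /= rn.
have h : expR r < n%:R.
  have /andP[_ h] := truncn_itv (expR_ge0 r).
  by apply: lt_le_trans h _; rewrite ler_nat.
rewrite -[leLHS]expRK ler_ln ?posrE ?expR_gt0 ?(ltW h) //.
exact: lt_trans (expR_gt0 r) h.
Qed.

Lemma cvg_expR_ln (R : realType) (C : R) : 0 <= C ->
  (fun n : nat => C * expR (- (ln n%:R / 80))) @ \oo --> 0.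
Proof.
move=> C0; apply/cvgr0Pnorm_le => e e0.
near=> n.
have hL : 80 * C / e <= ln n%:R by near: n; exact: near_ln_ge.
have L0 : 0 <= ln n%:R :> R.
  by apply: le_trans hL; apply: divr_ge0; [lra | exact: ltW].
have hC : 80 * C <= ln n%:R * e by rewrite -ler_pdivrMr.
rewrite ger0_norm ?mulr_ge0 ?expR_ge0 // expRN ler_pdivrMr ?expR_gt0 //.
apply: (@le_trans _ _ (e * (1 + ln n%:R / 80))); first by lra.
by rewrite ler_pM2l // expR_ge1Dx.
Unshelve. all: by end_near. Qed.

Lemma whp_hamiltonian (R : realType) (d : nat -> measure_display)
    (T : forall n : nat, measurableType (d n))
    (P : forall n : nat, probability (T n) R)
    (X : forall n : nat, T n -> {fset R * R}) (k : nat -> nat)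
    (kappa : nat) (C L0 : R) :
  0 <= C -> 0 < L0 ->
  (forall n, (0 < n)%N -> (0 < k n)%N -> ln n%:R <= 8 * (k n)%:R :> R ->
    exists E : set (T n), [/\ measurable E,
    (P n E <= (C * expR (- (ln n%:R / 80)))%:E)%E &
    forall w, ~ E w -> kappa_connected kappa (@knn_graph R (k n) (X n w)) ->
      hamiltonian (@knn_graph R (k n) (X n w))]) ->
  (forall n, L0 <= ln n%:R -> 8 * (k n)%:R < ln n%:R :> R ->
    exists E : set (T n), [/\ measurable E, (P n E <= (1 / 2)%:E)%E &
    forall w, ~ E w -> ~ kappa_connected kappa (@knn_graph R (k n) (X n w))]) ->
  whp P (fun n => [set w | kappa_connected kappa (@knn_graph R (k n) (X n w))]) ->
  whp P (fun n => [set w | hamiltonian (@knn_graph R (k n) (X n w))]).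
Proof.
move=> C0 L00 dense sparse [A [mA AE PA]].
have a1 : (fun n => fine (P n (A n))) @ \oo --> (1 : R) by exact: fine_cvg PA.
pose dense_at n := [/\ (0 < n)%N, (0 < k n)%N & ln n%:R <= 8 * (k n)%:R :> R].
have hB : forall n, exists B : set (T n), [/\ measurable B,
    B `<=` [set w | hamiltonian (@knn_graph R (k n) (X n w))] &
    dense_at n -> fine (P n (A n)) - C * expR (- (ln n%:R / 80)) <= fine (P n B)].
  move=> n; have [[n0 k0 nk]|nd] := pselect (dense_at n); last first.
    (* Only finitely many [n] fail to be dense, so the empty set does not affect the limit. *)
    by exists set0; split=> //; apply: measurable0.
  have [E [mE PE hE]] := dense n n0 k0 nk.
  have mB := measurableD (mA n) mE.
  exists (A n `\` E); split=> //.
    by move=> w [/AE cw nE]; exact: hE nE cw.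
  move=> _; rewrite -lee_fin EFinB -(fine_probability (P n) (mA n)).
  rewrite -(fine_probability (P n) mB) leeBlDr //; apply: (@le_trans _ _ (P n (A n `\` E) + P n E)%E); last exact: leeD2l.
  apply: le_trans (measureU2 (P n) mB mE).
  apply: le_measure; rewrite ?inE //; first exact: measurableU.
  by move=> w Aw; have [|] := pselect (E w); [right | left].
pose B n := sval (cid (hB n)).
have BP n : _ := svalP (cid (hB n)).
exists B; split; [by move=> n; have [] := BP n | by move=> n; have [] := BP n | ].
have finE n : P n (B n) = (fine (P n (B n)))%:E.
  by apply: fine_probability; have [] := BP n.
rewrite (eq_cvg _ _ finE); apply: cvg_EFin; first exact: nearW.
have lim1 : (fun n => fine (P n (A n)) - C * expR (- (ln n%:R / 80))) @ \oo --> (1 : R).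
  have := cvgB a1 (cvg_expR_ln C0); rewrite subr0; exact.
apply: (@squeeze_cvgr _ _ _ _ _ (fun=> 1) _ _ _ lim1 (cvg_cst _)).
near=> n.
have hA : 1 / 2 < fine (P n (A n)) by near: n; apply: (cvgr_gt _ a1); lra.
have hL : L0 <= ln n%:R by near: n; exact: near_ln_ge.
apply/andP; split; last first.
  have [mB _ _] := BP n.
  by have := probability_le1 (P n) mB; rewrite -/(B n) finE lee_fin.
have [_ _] := BP n; apply.
(* A sparse [n] would confine the connectivity event to a set of probability at most [1 / 2]. The
   argument is made for each large [n] separately, as nothing is assumed on the growth of [k]. *)
have nk : ln n%:R <= 8 * (k n)%:R :> R.
  rewrite leNgt; apply/negP => kn; have [E [mE PE hE]] := sparse n hL kn.
  have AE' : A n `<=` E.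
    by move=> w Aw; apply: contrapT => nE; apply: (hE w nE); exact: AE.
  have : (P n (A n) <= (1 / 2)%:E)%E.
    by apply: le_trans PE; apply: le_measure; rewrite ?inE.
  by rewrite (fine_probability (P n) (mA n)) lee_fin leNgt hA.
have ln0 : 0 < ln n%:R :> R by exact: lt_le_trans hL.
split=> //.
  by rewrite lt0n; apply: contraTneq ln0 => ->; rewrite ln0 // ltxx.
have : 0 < (k n)%:R :> R by lra.
by rewrite ltr0n.
Unshelve. all: by end_near. Qed.

Theorem theorem3 (R : realType) (d : nat -> measure_display)
    (T : forall n : nat, measurableType (d n))
    (P : forall n : nat, probability (T n) R)
    (X : forall n : nat, T n -> {fset R * R}) (k : nat -> nat)
    (HX : forall n : nat,
       poisson_process (P n) (square (Num.sqrt (n%:R : R))) (X n))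
    (Hconn : whp P (fun n =>
       [set w | kappa_connected (5 * 10 ^ 7)%N (@knn_graph R (k n) (X n w))])) :
  whp P (fun n => [set w | hamiltonian (@knn_graph R (k n) (X n w))]).
Proof.
have [C C0 dense] := dense_regime R.
have [L0 L00 sparse] := sparse_regime R.
apply: (whp_hamiltonian C0 L00 _ _ Hconn) => n.
  exact: dense (HX n).
by apply: sparse (HX n) _; exact: ltnW kappa_gt1.
Qed.
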